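(* Let $t_K^\star=\frac{K^2\log K}{\pi^2}$ and let $\tau_K^{\mathrm{SWT}}(\varepsilon)$ be the $\varepsilon$-mixing time of the SSEP with traps on the ring with $K$ sites. There exists $C>0$ such that for all integers $K\ge 2$ and all $0<\varepsilon<1$, $$\left|\tau_K^{\mathrm{SWT}}(\varepsilon)-t_K^\star\right|\le CK^2\left(1+\log\frac{\log K}{\varepsilon\wedge(1-\varepsilon)}\right).$$ In particular, the mixing time exhibits cutoff at time $t_K^\star$: for all $0<\varepsilon<1$, $$\lim_{K\to\infty}\frac{\tau_K^{\mathrm{SWT}}(\varepsilon)}{t_K^\star}=1 .$$
   Context: For an integer $K\ge 1$ let $\mathbb{T}_K=\{1,\dots,K\}$ be the periodic ring (indices mod $K$) and $\Gamma_K=\{n\in\mathbb{Z}: n\le 1\}^{\mathbb{T}_K}$. For $\xi\in\Gamma_K$: $\xi_k=1$ means site $k$ holds a (live) particle, $\xi_k=0$ means it is empty, $\xi_k<0$ means it holds a trap of depth $|\xi_k|$. The SSEP with traps (SWT) on $\mathbb{T}_K$ is the continuous-time Markov process on $\Gamma_K$ with generator $$\mathscr{L}f(\xi)=\sum_{k\in\mathbb{T}_K}\sum_{z=\pm1}\mathbf{1}_{\{\xi_k=1,\ \xi_{k+z}\le 0\}}\{f(\xi^{k,k+z})-f(\xi)\},$$ where $\xi^{k,k+z}$ equals $0$ at $k$, $\xi_{k+z}+1$ at $k+z$, and $\xi_{k'}$ at every other site $k'$. Let $\mathbf{P}^K_\xi$ be its law started from $\xi$. The number of excess particles $S(\xi)=\sum_{k}\xi_k$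 is conserved by the dynamics. For $0\le s\le K$ let $\Gamma_{K,s}=\{\xi\in\Gamma_K: S(\xi)=s\}$ and let $\pi_{K,s}$ be the uniform distribution on $\Sigma_{K,s}=\{\xi\in\{0,1\}^{\mathbb{T}_K}:\sum_k\xi_k=s\}$. With $d_{\mathrm{TV}}$ the total variation distance, $$\tau_K^{\mathrm{SWT}}(\varepsilon)=\inf\Big\{t\ge0:\ \sup_{0\le s\le K,\ \xi\in\Gamma_{K,s}} d_{\mathrm{TV}}\big(\mathbf{P}^K_\xi(\xi(t)\in\cdot),\pi_{K,s}\big)\le\varepsilon\Big\}.$$ *)

(* Defs.v *)
From HB Require Import structures.
From mathcomp Require Import all_boot all_order all_algebra.
From mathcomp Require Import finmap.
From mathcomp Require Import all_classical all_reals all_analysis.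
Set Implicit Arguments.
Unset Strict Implicit.
Unset Printing Implicit Defensive.
Import Order.TTheory GRing.Theory Num.Theory.
Import numFieldNormedType.Exports.
Local Open Scope classical_set_scope.
Local Open Scope ring_scope.

(* The sites 1..K of the ring are represented by 'I_K; [ordS] and [ord_pred]
   are the cyclic successor and predecessor. *)
Definition config (K : nat) : Type :=
  {x : {ffun 'I_K -> int} | [forall k, x k <= 1]}.

HB.instance Definition _ K := SubChoice.on (config K).

Lemma config0_subproof K : [forall k, [ffun _ : 'I_K => 0 : int] k <= 1].
Proof. by apply/forallP => k; rewrite ffunE. Qed.

Definition config0 K : config K :=
  exist (fun x : {ffun 'I_K -> int} => [forall k, x k <= 1]) _
    (config0_subproof K).

HB.instance Definition _ K := isPointed.Build (config K) (config0 K).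

(* Every set of configurations is an event. *)
HB.instance Definition _ K := @isMeasurable.Build default_measure_display
  (config K) discrete_measurable discrete_measurable0
  discrete_measurableC discrete_measurableU.

Definition can_jump K (xi : config K) (k l : 'I_K) : bool :=
  (val xi k == 1) && (val xi l <= 0).

(* The result satisfies the constraint [<= 1] whenever [can_jump xi k l] (see
   [val_jump]); otherwise the default value of [insubd] may be returned, but
   then the jump rate is 0. *)
Definition jump K (xi : config K) (k l : 'I_K) : config K :=
  insubd xi [ffun j => if j == k then 0
                       else if j == l then val xi l + 1
                       else val xi j].

Lemma val_jump K (xi : config K) (k l : 'I_K) : can_jump xi k l ->
  val (jump xi k l) = [ffun j => if j == k then 0
                                 else if j == l then val xi l + 1
                                 else val xi j].
Proof.
case/andP => _ l0; rewrite val_insubd ifT //; apply/forallP => j.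
rewrite ffunE; case: ifP => // _; case: ifP => _.
  by rewrite -[leRHS]add0r lerD2r.
by move: (valP xi) => /forallP/(_ j).
Qed.

(* The two neighbours are listed separately: for K = 2 they coincide, and the
   corresponding jump then has rate 2. *)
Definition swt_generator (R : realType) K (f : config K -> R) (xi : config K)
    : R :=
  \sum_(k < K) \sum_(l <- [:: ordS k; ord_pred k])
    (if can_jump xi k l then f (jump xi k l) - f xi else 0).

Section markov_process.
Context (R : realType) (d : measure_display) (Omega : measurableType d).
Context (K : nat) (P : config K -> probability Omega R).
Context (X : R -> {mfun Omega >-> config K}).

Definition past (s : R) : set (set Omega) :=
  <<s [set E | exists2 u, 0 <= u <= s &
                 exists B : set (config K), E = X u @^-1` B] >>.

(* [P xi] is the law of the process started from [xi]; only the times t >= 0 of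
   [X t] are relevant. The fields say that the paths are right-continuous for
   the discrete topology, that (X, P) is a time-homogeneous Markov process for
   its natural filtration, and that its generator is [swt_generator]. *)
Record is_SWT : Prop := {
  SWT_start : forall xi, P xi (X 0 @^-1` [set xi]) = 1%E;
  SWT_right_continuous : forall (w : Omega) (t : R), 0 <= t ->
    \forall s \near t^'+, X s w = X t w;
  SWT_markov : forall (xi : config K) (s h : R) (A : set Omega)
      (B : set (config K)), 0 <= s -> 0 <= h -> past s A ->
    P xi (A `&` X (s + h) @^-1` B) =
    (\int[P xi]_(w in A) P (X s w) (X h @^-1` B))%E;
  SWT_generator : forall (f : config K -> R) (xi : config K),
    (exists M : R, forall eta, `|f eta| <= M) ->
    h^-1 * ((\int[P xi]_w f (X h w)) - f xi) @[h --> (0 : R)^'+]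
      --> swt_generator f xi
}.

End markov_process.

Definition excess K (xi : config K) : int := \sum_(k < K) val xi k.

Definition Sigma K (s : nat) : set (config K) :=
  [set xi : config K | (forall k, val xi k = 0 \/ val xi k = 1) /\ excess xi = s%:Z].

Lemma finite_Sigma K s : finite_set (@Sigma K s).
Proof.
pose g (B : {set 'I_K}) : config K :=
  insubd (config0 K) [ffun k => if k \in B then 1 else 0].
apply: (@sub_finite_set _ _ (g @` setT)); last first.
  exact/finite_image/finite_finset.
move=> xi [xi01 _]; exists [set k | val xi k == 1]%SET => //.
apply/val_inj; rewrite val_insubd ifT; last first.
  by apply/forallP => k; rewrite ffunE; case: ifP.
by apply/ffunP => k; rewrite ffunE inE; have [->|->] := xi01 k.
Qed.

(* Meant for a nonempty finite set S; [fset_set] of an infinite set is empty. *)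
Definition uniform_on (R : realType) (T : choiceType) (S A : set T) : \bar R :=
  ((#|` fset_set (S `&` A)|)%:R / (#|` fset_set S|)%:R)%:E.

Definition dTV (R : realType) d (T : measurableType d)
    (mu nu : set T -> \bar R) : \bar R :=
  ereal_sup [set `|mu A - nu A|%E | A in [set A | measurable A]].

Section mixing_time.
Context (R : realType) (d : measure_display) (Omega : measurableType d).
Context (K : nat) (P : config K -> probability Omega R).
Context (X : R -> {mfun Omega >-> config K}).

Definition max_dTV (t : R) : \bar R :=
  ereal_sup [set x | exists (s : nat) (xi : config K),
    [/\ (s <= K)%N, excess xi = s%:Z &
        x = dTV (distribution (P xi) (X t)) (uniform_on R (@Sigma K s))]].

(* Extended-real infimum: +oo if there is no such t. *)
Definition mixing_time (eps : R) : \bar R :=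
  ereal_inf [set t%:E | t in [set t : R | 0 <= t /\ (max_dTV t <= eps%:E)%E]].

End mixing_time.

Definition tstar (R : realType) (K : nat) : R :=
  K%:R ^+ 2 * ln (K%:R) / pi ^+ 2.

(* Main.v *)
Require Import Defs.
From HB Require Import structures.
From mathcomp Require Import all_boot all_order all_algebra.
From mathcomp Require Import finmap fingroup perm ring lra zify.
From mathcomp Require Import all_classical all_reals all_analysis.
From mathcomp Require Import measurable_realfun.
Set Implicit Arguments.
Unset Strict Implicit.
Unset Printing Implicit Defensive.
Import Order.TTheory GRing.Theory Num.Theory.
Import numFieldNormedType.Exports.
Local Open Scope classical_set_scope.
Local Open Scope ring_scope.

(** Write lam L = 2 (1 - cos (pi / L)), the decay rate of the sine arch
  y |-> sin (pi y / L) under the walk that jumps at rate 1 to each neighbour.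
  Everything happens on finite classes of configurations that are closed under
  jumps; there the transition probabilities satisfy P_h = 1 + h Q + o(h)
  uniformly, where Q is the generator. Iterating this over n steps of length
  t / n turns inequalities on Q into inequalities on P_t: a function with
  Q f <= - l f satisfies P_t f <= exp (- l t) f ([expect_decay]), and couplings
  are replaced by seminorms that the Euler step f + h Q f contracts
  ([expect_level]). No process other than the given one is constructed.

  Lower bound. Start with one trap of depth K - 1 and live particles at all other
  sites. The trap absorbs every particle, and M, the sum of sin (pi k / K) over
  the live particles, is an eigenfunction of Q with eigenvalue - lam K, because
  exclusion is invisible to sums over particles ([sum_jumps]). Negative
  correlation ([generator_pairs]) bounds the variance of M by its mean, so some
  particle is still live at time t with probability at least m / (m + 1), where
  m = exp (- lam K t) M(0) is at least exp (- lam K t) K / pi. As lam K is at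
  most pi ^ 2 / K ^ 2, this gives the time
  t_star - O(K ^ 2 (1 + ln (1 / (1 - eps)))).

  Upper bound. Let s be the excess. If a trap is left then at least s + 1
  particles are live, and all of them have avoided that trap. Summing over the
  site of the trap would lose a factor K, so the ring is cut into about ln K
  blocks, and for each block the live particles are weighted by a sine arch of
  width L = K + 4 m, where m is the block length, unrolled from the last trap of
  the block. When that trap is filled and the reference moves back, no weight
  increases ([trap_profile_le]), so the total weight decays at rate lam L
  ([generator_block_potential]). The arch is wider than the ring, hence bounded
  below by a multiple of 1 / ln K, and a trap survives at time t with probability
  at most (ln K) ^ O(1) K exp (- lam L t) / (s + 1) ([prob_trap_le]).

  Once the traps are filled the process is the exclusion process, that is, the
  interchange process without labels ([generator_binary]). Compare P_t f at two
  configurations that differ by the exchange of the contents of p and q. Under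
  common exchanges of neighbours p and q perform walks that meet at double speed
  ([pair_profile_super]), so the difference decays at rate 2 lam L. At most s
  exchanges connect two configurations, and the distance to equilibrium is at
  most s (ln K) ^ O(1) exp (- 2 lam L t) ([exclusion_mixing]).

  Waiting a time about (ln K - ln (s + 1)) / lam L for the traps and then
  ln (s + 1) / lam L for the exclusion process adds up to ln K / lam L whatever
  s is ([mixing_time_le]). Since L = K (1 + O(1 / ln K)), this is
  t_star + O(K ^ 2), and the powers of ln K and the factor 1 / eps cost
  O(K ^ 2 (ln ln K + ln (1 / eps))). *)

(** * Trigonometric estimates *)

Lemma le_of_eq (R : realType) (x y : R) : x = y -> x <= y.
Proof. by move=> ->. Qed.

Section trigonometry.
Context {R : realType}.
Implicit Types x y L : R.

Lemma ge0_of_derive_ge0 (f df : R -> R) x :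
  (forall z : R, is_derive z (1 : R) f (df z)) -> f 0 = 0 ->
  (forall z, 0 <= z -> 0 <= df z) -> 0 <= x -> 0 <= f x.
Proof.
move=> fdf f0 df0 x0.
have fc : {within `[0, x], continuous f}.
  apply: continuous_subspaceT => z.
  apply: differentiable_continuous; apply/derivable1_diffP.
  by have [] := fdf z.
have [c c0x] := MVT_segment x0 (fun z _ => fdf z) fc.
rewrite f0 !subr0 => ->; apply: mulr_ge0 => //; apply: df0.
by move: c0x; rewrite in_itv/= => /andP[].
Qed.

Lemma sin_le_id x : 0 <= x -> sin x <= x.
Proof.
move=> x0; rewrite -subr_ge0.
apply: (@ge0_of_derive_ge0 (fun z => z - sin z) (fun z => 1 - cos z)) => //.
by rewrite sin0 subr0.
Qed.

Lemma cos_ge_quadratic x : 0 <= x -> 1 - x ^+ 2 / 2 <= cos x.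
Proof.
move=> x0; rewrite -subr_ge0.
apply: (@ge0_of_derive_ge0 (fun z => cos z - (1 - z ^+ 2 / 2))
  (fun z => z - sin z)) => //.
- move=> z; apply: is_derive_eq.
  by rewrite /GRing.scale/=; field.
- by rewrite cos0; lra.
- by move=> z z0; rewrite subr_ge0 sin_le_id.
Qed.

Lemma sin_ge_cubic x : 0 <= x -> x - x ^+ 3 / 6 <= sin x.
Proof.
move=> x0; rewrite -subr_ge0.
apply: (@ge0_of_derive_ge0 (fun z => sin z - (z - z ^+ 3 / 6))
  (fun z => cos z - (1 - z ^+ 2 / 2))) => //.
- move=> z; apply: is_derive_eq.
  by rewrite /GRing.scale/=; field.
- by rewrite sin0; lra.
- by move=> z z0; rewrite subr_ge0 cos_ge_quadratic.
Qed.

Lemma cos_le_quartic x : 0 <= x -> cos x <= 1 - x ^+ 2 / 2 + x ^+ 4 / 24.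
Proof.
move=> x0; rewrite -subr_ge0.
apply: (@ge0_of_derive_ge0 (fun z => 1 - z ^+ 2 / 2 + z ^+ 4 / 24 - cos z)
  (fun z => sin z - (z - z ^+ 3 / 6))) => //.
- move=> z; apply: is_derive_eq.
  by rewrite /GRing.scale/=; field.
- by rewrite cos0; lra.
- by move=> z z0; rewrite subr_ge0 sin_ge_cubic.
Qed.

Definition wave L y : R := sin (pi * y / L).

Definition rate L : R := 2 * (1 - cos (pi / L)).

Lemma wave_laplacian L y :
  wave L (y + 1) + wave L (y - 1) - 2 * wave L y = - rate L * wave L y.
Proof.
rewrite /wave /rate mulrDr mulrBr mulr1 mulrDl mulrBl sinD sinB.
by ring.
Qed.

Lemma wave0 L : wave L 0 = 0.
Proof. by rewrite /wave mulr0 mul0r sin0. Qed.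

Lemma wave_refl L y : 0 < L -> wave L (L - y) = wave L y.
Proof.
move=> L0; rewrite /wave mulrBr mulrBl mulfK ?gt_eqF//.
by rewrite sinB sinpi cospi mul0r sub0r mulN1r opprK.
Qed.

Lemma wave_ge0 L y : 0 < L -> 0 <= y <= L -> 0 <= wave L y.
Proof.
move=> L0 /andP[y0 yL]; apply: sin_ge0_pi.
rewrite divr_ge0 ?mulr_ge0 ?pi_ge0 ?(ltW L0)//=.
by rewrite ler_pdivrMr// ler_pM2l// pi_gt0.
Qed.

Lemma wave_le1 L y : wave L y <= 1.
Proof. exact: sin_le1. Qed.

(** Comparing the sines at u and v comes down to comparing the distances of the
  points to the middle L / 2 of the arch. *)
Lemma le_wave L u v : 0 < L -> 0 <= u -> u <= v -> u + v <= L ->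
  wave L u <= wave L v.
Proof.
move=> L0 u0 uv uvL; rewrite -subr_ge0.
set a := pi * (u + v) / (2 * L); set b := pi * (v - u) / (2 * L).
have -> : wave L v - wave L u = 2 * (cos a * sin b).
  have -> : wave L v = sin (a + b).
    by rewrite /wave; congr sin; rewrite /a /b; field; rewrite gt_eqF.
  have -> : wave L u = sin (a - b).
    by rewrite /wave; congr sin; rewrite /a /b; field; rewrite gt_eqF.
  by rewrite sinD sinB; ring.
have p0 := @pi_gt0 R.
have aE : a = pi * ((u + v) / (2 * L)) by rewrite /a mulrA.
have bE : b = pi * ((v - u) / (2 * L)) by rewrite /b mulrA.
have a1 : 0 <= (u + v) / (2 * L) <= 1 / 2.
  by rewrite divr_ge0 ?ler_pdivrMr /=; nra.
have b1 : 0 <= (v - u) / (2 * L) <= 1 / 2.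
  by rewrite divr_ge0 ?ler_pdivrMr /=; nra.
rewrite mulr_ge0// mulr_ge0//.
  by apply: cos_ge0_pihalf; rewrite aE; nra.
by apply: sin_ge0_pi; rewrite bE; nra.
Qed.

Lemma wave_ge L m y : 0 < L -> 0 <= m -> m <= y <= L - m -> m / (2 * L) <= wave L y.
Proof.
move=> L0 m0; wlog yL : y / y <= L / 2 => [hw|] /andP[my ymL].
  have [yL|yL] := lerP y (L / 2); first by apply: hw; rewrite // my.
  by rewrite -wave_refl//; apply: hw; lra.
set z := y / L.
have z0 : 0 <= z by rewrite divr_ge0 ?(le_trans m0 my) ?(ltW L0).
have z2 : z <= 1 / 2 by rewrite ler_pdivrMr//; lra.
have mz : m / (2 * L) <= z / 2.
  by rewrite invfM mulrA mulrAC ler_pM2r// ler_pM2r// invr_gt0.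
apply: (le_trans mz).
rewrite /wave -mulrA -/z.
have p2 := @pi_ge2 R; have p4 := @pihalf_lt2 R.
set w := pi * z.
have w0 : 0 <= w by rewrite mulr_ge0// pi_ge0.
have w2 : w <= 2 by rewrite /w; nra.
apply: le_trans (sin_ge_cubic w0).
have wz : 2 * z <= w by rewrite /w; nra.
have : w ^+ 3 <= 4 * w.
  by rewrite exprSr ler_wpM2r//; nra.
lra.
Qed.

Lemma rate_le L : 0 < L -> rate L <= pi ^+ 2 / L ^+ 2.
Proof.
move=> L0; have := @cos_ge_quadratic (pi / L) _.
rewrite divr_ge0 ?pi_ge0 ?(ltW L0)// => /(_ isT).
by rewrite expr_div_n /rate; lra.
Qed.

Lemma rate_inv L : 2 <= L -> 0 < rate L /\ (rate L)^-1 <= L ^+ 2 / pi ^+ 2 + 1.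
Proof.
move=> L2; have L0 : 0 < L by lra.
have p0 := @pi_gt0 R; have p4 := @pihalf_lt2 R.
set x := pi / L.
have x0 : 0 < x by rewrite divr_gt0.
have x2 : x <= 2 by rewrite ler_pdivrMr//; nra.
have xx : x ^+ 2 <= 4 by rewrite expr2; nra.
have xx0 : 0 < x ^+ 2 by rewrite exprn_gt0.
have rE : x ^+ 2 * (1 - x ^+ 2 / 12) <= rate L.
  have := cos_le_quartic (ltW x0); rewrite /rate -/x.
  rewrite (_ : x ^+ 4 = x ^+ 2 * x ^+ 2); last by rewrite -exprD.
  by lra.
have r0 : 0 < rate L by apply: lt_le_trans rE; rewrite mulr_gt0//; lra.
split => //.
have -> : L ^+ 2 / pi ^+ 2 = (x ^+ 2)^-1 by rewrite -expr_div_n -exprVn invf_div.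
rewrite -div1r ler_pdivrMr//.
apply: (@le_trans _ _ (((x ^+ 2)^-1 + 1) * (x ^+ 2 * (1 - x ^+ 2 / 12)))).
  rewrite mulrA mulrDl mulVf ?gt_eqF// mul1r; nra.
by rewrite ler_wpM2l// addr_ge0// invr_ge0 ltW.
Qed.

End trigonometry.

(** * Finite Markov semigroups *)

Section finite_semigroup.
Context {R : realType} {T : eqType}.
Variables (r : seq T) (p : R -> T -> T -> R) (Q : (T -> R) -> T -> R).
Implicit Types (f g : T -> R) (t h e M : R).

Definition expect t f x : R := \sum_(y <- r) p t x y * f y.

(** The expansion [fs_generator] is uniform over bounded f: the Euler steps below
  act on functions that change from one step to the next. *)
Record finite_semigroup : Prop := {
  fs_ge0 : forall t x y, 0 <= t -> x \in r -> y \in r -> 0 <= p t x y;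
  fs_mass : forall t x, 0 <= t -> x \in r -> \sum_(y <- r) p t x y = 1;
  fs_start : forall f x, x \in r -> expect 0 f x = f x;
  fs_semigroup : forall s t x z, 0 <= s -> 0 <= t -> x \in r -> z \in r ->
    p (s + t) x z = \sum_(y <- r) p s x y * p t y z;
  fs_generator : forall e, 0 < e -> exists2 d, 0 < d & forall h M f,
    0 < h < d -> (forall y, y \in r -> `|f y| <= M) ->
    forall x, x \in r -> `|expect h f x - (f x + h * Q f x)| <= e * h * M
}.

Hypothesis S : finite_semigroup.

Lemma expectD s t f x : 0 <= s -> 0 <= t -> x \in r ->
  expect (s + t) f x = expect s (expect t f) x.
Proof.
move=> s0 t0 xr; rewrite /expect.
under eq_big_seq => z zr.
  rewrite (fs_semigroup S s0 t0 xr zr) big_distrl/=.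
  under eq_bigr do rewrite -mulrA.
  over.
rewrite exchange_big/=; apply: eq_bigr => y _.
by rewrite big_distrr.
Qed.

Lemma expect_le t f g x : 0 <= t -> x \in r ->
  (forall y, y \in r -> f y <= g y) -> expect t f x <= expect t g x.
Proof.
move=> t0 xr fg; rewrite /expect !big_seq; apply: ler_sum => y yr.
by rewrite ler_wpM2l ?fg// (fs_ge0 S).
Qed.

Lemma expect_affine t a f b x : 0 <= t -> x \in r ->
  expect t (fun y => a * f y + b) x = a * expect t f x + b.
Proof.
move=> t0 xr; rewrite /expect big_distrr/=.
under eq_bigr do rewrite mulrDr.
rewrite big_split/= -big_distrl/= (fs_mass S)// mul1r.
by congr +%R; apply: eq_bigr => y _; rewrite mulrCA.
Qed.

Lemma expect_cst t b x : 0 <= t -> x \in r -> expect t (fun=> b) x = b.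
Proof.
by move=> t0 xr; rewrite /expect -big_distrl/= (fs_mass S)// mul1r.
Qed.

Lemma expect_bounded t f M : 0 <= t -> (forall y, y \in r -> `|f y| <= M) ->
  forall x, x \in r -> `|expect t f x| <= M.
Proof.
move=> t0 fM x xr; rewrite ler_norml; apply/andP; split.
  rewrite -(expect_cst (- M) t0 xr); apply: expect_le => // y /fM.
  by rewrite ler_norml => /andP[].
rewrite -(expect_cst M t0 xr); apply: expect_le => // y /fM.
by rewrite ler_norml => /andP[].
Qed.

Lemma exists_bound f : exists2 M, 0 <= M & forall y, y \in r -> `|f y| <= M.
Proof.
exists (\sum_(y <- r) `|f y|); first exact: sumr_ge0.
move=> y yr; rewrite (big_rem y)//= lerDl; exact: sumr_ge0.
Qed.

(** From the convexity bound at - u: exp u <= 1 / (1 - u). *)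
Lemma expR_le_quadratic (u : R) : `|u| <= 1 / 2 -> expR u <= 1 + u + 2 * u ^+ 2.
Proof.
rewrite ler_norml => /andP[u1 u2].
have := expR_ge1Dx (- u); rewrite expRN => h.
have e0 := expR_gt0 u.
have : expR u * (1 - u) <= 1.
  by apply: (le_trans (ler_wpM2l (ltW e0) h)); rewrite mulfV ?gt_eqF.
rewrite expr2 => H.
have : 1 <= (1 - u) * (1 + u + 2 * (u * u)) by nra.
have : 0 < 1 - u by lra.
move=> u3 H'.
rewrite -(ler_pM2l u3); apply: le_trans H'.
by rewrite mulrC.
Qed.

Lemma exists_subdivision t (d : R) : 0 <= t -> 0 < d ->
  exists n : nat, [/\ (0 < n)%N & t / n%:R < d].
Proof.
move=> t0 d0.
have : 0 <= t / d by rewrite divr_ge0// ltW.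
move=> /archi_boundP; set n := Num.bound _ => tn.
exists n.+1; split => //.
rewrite ltr_pdivrMr ?ltr0n// mulrC -ltr_pdivrMr//.
by apply: lt_trans tn _; rewrite ltr_nat.
Qed.

(** The one-step bound P_h f <= exp (- l h) f + o(h) is iterated over n steps
  of length t / n: positivity of the semigroup lets the errors add up to
  n o(t / n), which vanishes in the limit. *)
Lemma expect_decay (l : R) f : 0 <= l ->
  (forall x, x \in r -> Q f x <= - l * f x) ->
  forall t x, 0 <= t -> x \in r -> expect t f x <= expR (- l * t) * f x.
Proof.
move=> l0 Qf t x t0 xr.
have [M M0 fM] := exists_bound f.
apply/ler_addgt0Pr => e e0.
pose e1 := e / (2 * t * M + 1).
have tM0 : 0 <= 2 * t * M by rewrite !mulr_ge0.
have e10 : 0 < e1 by rewrite divr_gt0//; lra.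
have [d d0 gen] := fs_generator S e10.
pose d1 := Num.min d (Num.min (1 / (2 * (l + 1))) (e1 / (2 * l ^+ 2 + 1))).
have l20 := sqr_ge0 l.
have d10 : 0 < d1.
  by rewrite !lt_min d0 !divr_gt0//; lra.
have [t00|t1] := eqVneq t 0.
  by rewrite t00 mulr0 expR0 mul1r (fs_start S)// lerDl ltW.
have {}t1 : 0 < t by rewrite lt_def t1.
have [n [n0 tn]] := exists_subdivision t0 d10.
set h := t / n%:R in tn.
have n0R : 0 < n%:R :> R by rewrite ltr0n.
have h0 : 0 < h by rewrite divr_gt0.
have nh : n%:R * h = t by rewrite mulrC divfK// gt_eqF.
have e1E : e1 = e / (2 * t * M + 1) by [].
clearbody e1 h.
have := tn; rewrite !lt_min => /and3P[hd hl he].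
have lh : l * h <= 1 / 2.
  move: hl; rewrite ltr_pdivlMr; nra.
have step y : y \in r -> expect h f y <= expR (- l * h) * f y + 2 * e1 * h * M.
  move=> yr; have := gen h M f _ fM y yr; rewrite h0 hd => /(_ isT).
  rewrite ler_norml => /andP[_ H1].
  have H2 : h * Q f y <= h * (- l * f y) by rewrite ler_wpM2l ?Qf ?ltW.
  have lh0 : 0 <= l * h by rewrite mulr_ge0// ltW.
  have E1 := expR_ge1Dx (- l * h).
  have E2 : expR (- l * h) <= 1 + - l * h + 2 * (- l * h) ^+ 2.
    by apply: expR_le_quadratic; rewrite mulNr normrN ger0_norm.
  have E3 : 2 * (- l * h) ^+ 2 <= e1 * h.
    have : h * (2 * l ^+ 2 + 1) <= e1 by rewrite ltW// -ltr_pdivlMr//; lra.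
    rewrite mulNr sqrrN exprMn => H3.
    have -> : 2 * (l ^+ 2 * h ^+ 2) = (h * (2 * l ^+ 2)) * h by ring.
    by rewrite ler_pM2r//; lra.
  have := fM y yr; rewrite ler_norml => /andP[fM1 fM2].
  have E4 : (1 - l * h - expR (- l * h)) * f y <= e1 * h * M.
    apply: le_trans (ler_norm _) _; rewrite normrM ler_pM ?fM//.
    by rewrite ler_norml; apply/andP; split; lra.
  move: H1 H2 E4; set A := expR _; set B := Q f y; set D := expect _ _ _; lra.
have iter k y : y \in r ->
    expect (k%:R * h) f y <= expR (- l * (k%:R * h)) * f y + k%:R * (2 * e1 * h * M).
  elim: k y => [|k IH] y yr.
    by rewrite !mul0r mulr0 expR0 mul1r addr0 (fs_start S).
  have kh0 : 0 <= k%:R * h by rewrite mulr_ge0// ltW.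
  have -> : k.+1%:R * h = k%:R * h + h by rewrite -addn1 natrD mulrDl mul1r.
  rewrite expectD ?(ltW h0)//.
  apply: (@le_trans _ _ (expect (k%:R * h)
    (fun z => expR (- l * h) * f z + 2 * e1 * h * M) y)).
    exact: expect_le.
  rewrite expect_affine// mulrDr expRD.
  have E1 : expR (- l * h) <= 1 by rewrite expR_le1 mulNr oppr_le0 mulr_ge0// ltW.
  have E0 := expR_ge0 (- l * h).
  have X0 : 0 <= 2 * e1 * h * M by rewrite !mulr_ge0// ?(ltW e10) ?(ltW h0).
  have k0 : 0 <= k%:R :> R by [].
  have -> : k.+1%:R = k%:R + 1 :> R by rewrite -addn1 natrD.
  have := ler_wpM2l E0 (IH y yr).
  have kX : 0 <= k%:R * (2 * e1 * h * M) by rewrite mulr_ge0.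
  have := ler_wpM2r kX E1.
  set A := expR (- l * h); set B := expR (- l * (k%:R * h)); set X := 2 * e1 * h * M.
  move: (expect _ _ _) => D ? ?.
  apply: (@le_trans _ _ (A * (B * f y + k%:R * X) + X)); first by rewrite lerD2r.
  have -> : A * (B * f y + k%:R * X) + X = B * A * f y + A * (k%:R * X) + X by ring.
  have -> : B * A * f y + (k%:R + 1) * X = B * A * f y + 1 * (k%:R * X) + X by ring.
  by rewrite !lerD2r lerD2l.
have := iter n x xr; rewrite nh => /le_trans; apply.
rewrite lerD2l.
have -> : n%:R * (2 * e1 * h * M) = (n%:R * h) * (2 * M) * e1 by ring.
rewrite nh e1E mulrA ler_pdivrMr; last lra.
have -> : t * (2 * M) * e = e * (2 * t * M) by ring.
by rewrite ler_wpM2l ?ltW//; lra.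
Qed.

(** Same iteration, now acting on an evolving function: if the Euler step
  f + h Q f improves the level c of f by the factor 1 - l h, then the level
  decays like exp (- l t). *)
Lemma expect_level (C : R -> (T -> R) -> Prop) (l k h1 : R) :
  0 <= l -> 0 <= k -> 0 < h1 ->
  (forall c c' f, C c f -> c <= c' -> C c' f) ->
  (forall c f g e, C c f -> (forall y, y \in r -> `|g y - f y| <= e) ->
    C (c + k * e) g) ->
  (forall c f h, 0 <= c -> 0 < h < h1 -> C c f ->
    C ((1 - l * h) * c) (fun x => f x + h * Q f x)) ->
  forall c f t e, 0 <= c -> 0 <= t -> 0 < e -> C c f ->
    C (expR (- l * t) * c + e) (expect t f).
Proof.
move=> l0 k0 h10 Cle Cpert Cstep c f t e c0 t0 e0 Cf.
have [t00|t1] := eqVneq t 0.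
  rewrite t00 mulr0 expR0 mul1r.
  apply: (Cle (c + k * 0)); last by rewrite mulr0 lerD2l ltW.
  by apply: Cpert Cf _ => y yr; rewrite (fs_start S)// subrr normr0.
have {}t1 : 0 < t by rewrite lt_def t1.
have [M M0 fM] := exists_bound f.
pose e1 := e / (k * t * M + 1).
have tM0 : 0 <= k * t * M by rewrite !mulr_ge0.
have e10 : 0 < e1 by rewrite divr_gt0//; lra.
have [d d0 gen] := fs_generator S e10.
have d10 : 0 < Num.min d h1 by rewrite lt_min d0.
have [n [n0 tn]] := exists_subdivision t0 d10.
set h := t / n%:R in tn.
have n0R : 0 < n%:R :> R by rewrite ltr0n.
have h0 : 0 < h by rewrite divr_gt0.
have nh : n%:R * h = t by rewrite mulrC divfK// gt_eqF.
have e1E : e1 = e / (k * t * M + 1) by [].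
clearbody e1 h.
have := tn; rewrite !lt_min => /andP[hd hh1].
have iter j : C (expR (- l * (j%:R * h)) * c + j%:R * (k * (e1 * h * M)))
    (expect (j%:R * h) f).
  elim: j => [|j IH].
    rewrite !mul0r mulr0 expR0 mul1r.
    have := Cpert _ _ (expect 0 f) 0 Cf; rewrite mulr0; apply => y yr.
    by rewrite (fs_start S)// subrr normr0.
  have jh0 : 0 <= j%:R * h by rewrite mulr_ge0// ltW.
  have -> : j.+1%:R * h = h + j%:R * h by rewrite -addn1 natrD mulrDl mul1r addrC.
  set u := expect (j%:R * h) f in IH.
  have uM := expect_bounded jh0 fM.
  set cj := _ + _ in IH.
  have X0 : 0 <= k * (e1 * h * M) by rewrite !mulr_ge0// ?(ltW e10) ?(ltW h0).
  have cj0 : 0 <= cj.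
    by rewrite /cj addr_ge0// mulr_ge0// expR_ge0.
  have := Cstep _ _ h cj0 _ IH; rewrite h0 hh1 => /(_ isT) Cs.
  have h0hd : 0 < h < d by rewrite h0.
  apply: (@Cle ((1 - l * h) * cj + k * (e1 * h * M))).
    apply: (Cpert _ _ _ _ Cs) => y yr.
    by rewrite expectD ?(ltW h0)//; exact: gen.
  have AA := expR_ge1Dx (- l * h).
  have B0 := expR_ge0 (- l * (j%:R * h)).
  have lh : 0 <= l * h by rewrite mulr_ge0// ltW.
  have jX : 0 <= j%:R * (k * (e1 * h * M)) by rewrite mulr_ge0.
  rewrite /cj (mulrDr (- l)) expRD -addn1 natrD.
  move: AA B0 jX X0; set A := expR (- l * h); set B := expR (- l * (j%:R * h)).
  set X := k * (e1 * h * M); set Y := j%:R * X => AA B0 Y0 X0.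
  have : (1 - l * h) * (B * c) <= A * (B * c) by rewrite ler_wpM2r ?mulr_ge0//; lra.
  have : (1 - l * h) * Y <= 1 * Y by rewrite ler_wpM2r//; lra.
  have YE : Y = j%:R * X by [].
  clearbody Y X A B; rewrite (mulrDl j%:R) mul1r -YE; lra.
have := iter n; rewrite nh => /Cle; apply.
rewrite lerD2l.
have -> : n%:R * (k * (e1 * h * M)) = (n%:R * h) * (k * M) * e1 by ring.
rewrite nh e1E mulrA ler_pdivrMr; last lra.
have -> : t * (k * M) * e = e * (k * t * M) by ring.
by rewrite ler_wpM2l ?ltW//; lra.
Qed.

End finite_semigroup.

(** * The law of the process on a finite closed class *)

Definition closed_class K (r : seq (config K)) : Prop :=
  forall (x : config K) (k l : 'I_K), x \in r -> can_jump x k l ->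
    jump x k l \in r.

Section generator.
Context {R : realType} {K : nat}.
Implicit Types (f g : config K -> R) (x y : config K) (r : seq (config K)).

Lemma swt_generator_local r f g x : closed_class r -> x \in r ->
  {in r, f =1 g} -> swt_generator f x = swt_generator g x.
Proof.
move=> cr xr fg; apply: eq_bigr => k _; apply: eq_bigr => l _.
by case: ifP => // jkl; rewrite !fg//; exact: cr.
Qed.

Lemma swt_generator0 x : swt_generator (fun=> 0 : R) x = 0.
Proof.
by rewrite /swt_generator big1// => k _; rewrite big1// => l _; case: ifP; rewrite ?subrr.
Qed.

Lemma swt_generator_sum (r : seq (config K)) (a : config K -> R)
    (f : config K -> config K -> R) x :
  swt_generator (fun z => \sum_(y <- r) f y z * a y) x =
  \sum_(y <- r) swt_generator (f y) x * a y.
Proof.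
rewrite /swt_generator.
under [RHS]eq_bigr do rewrite big_distrl/=.
rewrite exchange_big/=; apply: eq_bigr => k _.
under [RHS]eq_bigr do rewrite big_distrl/=.
rewrite exchange_big/=; apply: eq_bigr => l _.
case: ifP => _; last by rewrite big1// => y _; rewrite mul0r.
by rewrite -sumrB; apply: eq_bigr => y _; rewrite mulrBl.
Qed.

Lemma sum_indic_mul r (f : config K -> R) x : uniq r -> x \in r ->
  \sum_(y <- r) \1_[set y] x * f y = f x.
Proof.
move=> ur xr; rewrite (bigD1_seq x)//= indicE mem_set// mul1r big1 ?addr0// => y yx.
by rewrite indicE memNset ?mul0r//= => xy; rewrite xy eqxx in yx.
Qed.

End generator.

Lemma near_all (T : eqType) (U : Type) (F : set_system U) (s : seq T)
    (A : T -> U -> Prop) : Filter F ->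
  (forall y, y \in s -> \forall u \near F, A y u) ->
  \forall u \near F, forall y, y \in s -> A y u.
Proof.
move=> FF; elim: s => [|z s IH] H; first exact: nearW.
have /IH h1 : forall y, y \in s -> \forall u \near F, A y u.
  by move=> y ys; apply: H; rewrite inE ys orbT.
have h2 := H z (mem_head _ _).
apply: filterS2 h1 h2 => u h1 h2 y; rewrite inE => /orP[/eqP->//|]; exact: h1.
Qed.

Section law.
Context {R : realType} {d : measure_display} {Omega : measurableType d}.
Context {K : nat} {P : config K -> probability Omega R}.
Context {X : R -> {mfun Omega >-> config K}}.
Hypothesis HX : is_SWT P X.
Implicit Types (x y : config K) (r : seq (config K)) (B : set (config K)).

Lemma measurable_event t B : measurable (X t @^-1` B).
Proof. by rewrite -[_ @^-1` _]setTI; exact: (measurable_funPT (X t)). Qed.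

Lemma measurable_of_state t (g : config K -> \bar R) :
  measurable_fun setT ((fun w => g (X t w)) : Omega -> \bar R).
Proof.
by move=> _ B mB; rewrite setTI; exact: (measurable_event t (g @^-1` B)).
Qed.

Lemma past_setT s : 0 <= s -> past X s setT.
Proof.
move=> s0; apply: sub_sigma_algebra; exists 0; first by rewrite lexx.
by exists setT; rewrite preimage_setT.
Qed.

Definition trans t x y : R := fine (P x (X t @^-1` [set y])).

Lemma prob_fin_num t x B : P x (X t @^-1` B) \is a fin_num.
Proof. by apply: fin_num_measure; exact: measurable_event. Qed.

Lemma integral_indic_state x t B :
  (\int[P x]_w (\1_B (X t w))%:E)%E = P x (X t @^-1` B).
Proof.
rewrite -[in RHS](setIT (X t @^-1` B)) -integral_indic//.
exact: measurable_event.
Qed.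

Lemma prob_generator x B :
  h^-1 * (fine (P x (X h @^-1` B)) - \1_B x) @[h --> (0 : R)^'+]
    --> swt_generator (\1_B : _ -> R) x.
Proof.
have H := @SWT_generator _ _ _ _ _ _ HX (\1_B : _ -> R) x.
have {}H := H (ex_intro _ 1 _); apply: cvg_trans (H _); last first.
  by move=> y; rewrite indicE; case: (_ \in _); rewrite ?normr1 ?normr0.
apply: near_eq_cvg; apply: nearW => h /=; congr (_ * (_ - _)).
by rewrite /Rintegral integral_indic_state.
Qed.

Lemma right_nbhs0_interval (A : R -> Prop) : (\forall h \near 0^'+, A h) ->
  exists2 e, 0 < e & forall h, 0 < h < e -> A h.
Proof.
move=> [e/= e0 He]; exists e => // h /andP[h0 he]; apply: He => //=.
by rewrite sub0r normrN gtr0_norm.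
Qed.

Lemma prob_start_out x B : ~ B x -> P x (X 0 @^-1` B) = 0%E.
Proof.
move=> Bx; apply/eqP; rewrite eq_le measure_ge0 andbT.
have mx := measurable_event 0 [set x].
apply: (@le_trans _ _ (P x (~` (X 0 @^-1` [set x])))).
  apply: le_measure; rewrite ?inE; [exact: measurable_event|exact: measurableC|].
  by move=> u/= Bu ux; apply: Bx; rewrite -ux.
by rewrite probability_setC// (SWT_start HX) subee.
Qed.

(** Leaving a finite closed class in time h has probability o(h) uniformly over
  the class, hence, cutting [0, t] into n pieces, probability n o(t / n). *)
Lemma prob_leave r x t : closed_class r -> x \in r -> 0 <= t ->
  P x (X t @^-1` [set y | y \notin r]) = 0%E.
Proof.
move=> cr xr t0; set B := [set y | y \notin r].
pose w t x := fine (P x (X t @^-1` B)).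
have wE s y : P y (X s @^-1` B) = (w s y)%:E by rewrite /w fineK// prob_fin_num.
have w0 s y : 0 <= w s y by rewrite -lee_fin -wE measure_ge0.
have small e : 0 < e -> exists2 h0, 0 < h0 &
    forall h, 0 < h < h0 -> forall y, y \in r -> w h y <= e * h.
  move=> e0; apply: right_nbhs0_interval; apply: near_all => y yr.
  have := @prob_generator y B.
  rewrite (@swt_generator_local _ _ r _ (fun=> 0))//; last first.
    by move=> z zr; rewrite indicE memNset// /B/= zr.
  rewrite swt_generator0 => /cvgrPdist_le/(_ e e0) H.
  have h0 := nbhs_right_gt (0 : R).
  apply: filterS2 H h0 => h; rewrite indicE memNset /B/= ?yr// subr0 sub0r normrN.
  move=> H h0; rewrite -ler_pdivrMr// mulrC; exact: le_trans (ler_norm _) H.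
have step s h e : 0 <= s -> 0 <= h -> 0 <= e ->
    (forall y, y \in r -> w h y <= e) ->
    forall y, w (s + h) y <= w s y + e.
  move=> s0 h0 e0 H y; rewrite -lee_fin EFinD -!wE.
  rewrite -[X in P y X](setTI).
  rewrite (SWT_markov HX)//; last exact: past_setT.
  apply: (@le_trans _ _ (\int[P y]_w0 ((\1_B (X s w0))%:E + e%:E))%E).
    apply: ge0_le_integral => //.
    - exact: (measurable_of_state s (fun z => P z (X h @^-1` B))).
    - exact: (measurable_of_state s (fun z => (\1_B z)%:E + e%:E)%E).
    - move=> u _; rewrite wE -EFinD lee_fin.
      have [Br|Br] := boolP (X s u \in r).
        by apply: (le_trans (H _ Br)); rewrite lerDr.
      rewrite indicE mem_set//= -[leLHS]addr0 lerD//.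
      by rewrite -lee_fin -wE probability_le1//; exact: measurable_event.
  rewrite ge0_integralD//; last first.
    exact: (measurable_of_state s (fun z => (\1_B z)%:E)).
  rewrite integral_cst//= probability_setT mule1 leeD2r//.
  by rewrite integral_indic_state.
have w00 : w 0 x = 0.
  by rewrite /w prob_start_out// /B/= xr.
have wt : w t x <= 0.
  have [->|t1] := eqVneq t 0; first by rewrite w00.
  have {}t1 : 0 < t by rewrite lt_def t1.
  apply/ler_addgt0Pr => e e0; rewrite add0r.
  have et0 : 0 < e / t by rewrite divr_gt0.
  have [h0 h00 Hh] := small _ et0.
  have [n [n0 tn]] := exists_subdivision t0 h00.
  set h := t / n%:R in tn.
  have n0R : 0 < n%:R :> R by rewrite ltr0n.
  have hp : 0 < h by rewrite divr_gt0.
  have iter k : w (k%:R * h) x <= k%:R * (e / t * h).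
    elim: k => [|k IH]; first by rewrite !mul0r w00.
    have -> : k.+1%:R * h = k%:R * h + h by rewrite -addn1 natrD mulrDl mul1r.
    have -> : k.+1%:R * (e / t * h) = k%:R * (e / t * h) + e / t * h.
      by rewrite -addn1 natrD mulrDl mul1r.
    have eth0 : 0 <= e / t * h by rewrite mulr_ge0 ?ltW.
    apply: (@le_trans _ _ (w (k%:R * h) x + e / t * h)); last by rewrite lerD2r.
    apply: step => //; [by rewrite mulr_ge0 ?(ltW hp) | exact: ltW |].
    by apply: Hh; rewrite hp.
  have nh : n%:R * h = t by rewrite mulrC divfK// gt_eqF.
  have := iter n; rewrite nh; move/le_trans; apply.
  by rewrite mulrCA nh divfK// gt_eqF.
by rewrite wE; congr (_%:E); apply/eqP; rewrite eq_le wt w0.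
Qed.

(** The integrand equals almost surely a finite combination of indicators, since
  the class is never left. *)
Lemma integral_of_state r x t (g : config K -> R) : uniq r -> closed_class r ->
  x \in r -> 0 <= t -> (forall y, 0 <= g y) ->
  (\int[P x]_w (g (X t w))%:E)%E = (\sum_(y <- r) trans t x y * g y)%:E.
Proof.
move=> ur cr xr t0 g0.
rewrite (@ge0_ae_eq_integral _ _ _ _ setT _
  (fun w => \sum_(y <- r) (g y * \1_(X t @^-1` [set y]) w)%:E)%E)//; first last.
- exists (X t @^-1` [set y | y \notin r]); split.
  + exact: measurable_event.
  + exact: prob_leave.
  + move=> w/= H; apply/negP => wr; apply: H => _.
    rewrite sumEFin; congr (_%:E).
    rewrite -[LHS](sum_indic_mul g ur wr); apply: eq_bigr => y _.
    by rewrite mulrC !indicE.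
- by move=> w _; apply: sume_ge0 => y _; rewrite lee_fin mulr_ge0// indicE.
- by move=> w _; rewrite lee_fin.
- exact: (measurable_of_state t (fun z =>
    \sum_(y <- r) (g y * \1_([set y]) z)%:E)%E).
- exact: (measurable_of_state t (fun z => (g z)%:E)).
rewrite ge0_integral_sum//; first last.
- by move=> y w _; rewrite lee_fin mulr_ge0.
- by move=> y; exact: (measurable_of_state t (fun z => (g y * \1_([set y]) z)%:E)).
rewrite -sumEFin; apply: eq_bigr => y _.
under eq_integral do rewrite EFinM.
rewrite ge0_integralZl_EFin//; last first.
  exact: (measurable_of_state t (fun z => (\1_([set y]) z)%:E)).
rewrite integral_indic//; last exact: measurable_event.
by rewrite setIT EFinM muleC /trans fineK// prob_fin_num.
Qed.

Lemma prob_event r x t B : uniq r -> closed_class r -> x \in r -> 0 <= t ->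
  P x (X t @^-1` B) = (expect r trans t (\1_B : _ -> R) x)%:E.
Proof.
move=> ur cr xr t0; rewrite -(@integral_of_state r)//.
by rewrite integral_indic_state.
Qed.

(** The generator of the process is only given pointwise in f. On a finite class
  it suffices to know it for the indicators of the finitely many states, and the
  uniformity in f follows. *)
Lemma swt_finite_semigroup r : uniq r -> closed_class r ->
  finite_semigroup r trans (@swt_generator R K).
Proof.
move=> ur cr; split.
- by move=> t x y _ _ _; rewrite fine_ge0.
- move=> t x t0 xr; apply/EFin_inj.
  have := @prob_event r x t setT ur cr xr t0.
  rewrite preimage_setT probability_setT => ->; congr (_%:E).
  by apply: eq_bigr => y _; rewrite indicT mulr1.
- move=> f x xr.
  have Px := SWT_start HX x.
  have t1 : trans 0 x x = 1 by rewrite /trans Px.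
  have t0 y : y != x -> trans 0 x y = 0.
    move=> yx; apply/EFin_inj; rewrite /trans fineK ?prob_fin_num//.
    by rewrite prob_start_out//= => xy; rewrite xy eqxx in yx.
  rewrite /expect (bigD1_seq x)//= t1 mul1r big1 ?addr0// => y yx.
  by rewrite t0 ?mul0r.
- move=> s t x z s0 t0 xr zr; apply/EFin_inj.
  rewrite {1}/trans fineK ?prob_fin_num//.
  rewrite -[X in P x X](setTI) (SWT_markov HX)//; last exact: past_setT.
  rewrite -(@integral_of_state r x s (fun y => trans t y z))//; last first.
    by move=> y; rewrite fine_ge0.
  by apply: eq_integral => w _; rewrite /trans fineK ?prob_fin_num.
- move=> e e0.
  pose n := (size r).+1.
  have en0 : 0 < e / n%:R by rewrite divr_gt0.
  have [d0 d00 H] : exists2 d0 : R, 0 < d0 & forall h, 0 < h < d0 ->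
      forall x, x \in r -> forall y, y \in r ->
      `|h^-1 * (trans h x y - \1_[set y] x) - swt_generator (\1_[set y] : _ -> R) x|
        <= e / n%:R.
    apply: right_nbhs0_interval; apply: near_all => x xr; apply: near_all => y yr.
    have /cvgrPdist_le/(_ _ en0) := @prob_generator x [set y].
    by apply: filterS => h; rewrite distrC.
  exists d0 => // h M f hd fM x xr.
  have /andP[h0 _] := hd.
  rewrite -[f x](sum_indic_mul f ur xr).
  rewrite (@swt_generator_local _ _ r f
    (fun z => \sum_(y <- r) \1_[set y] z * f y))//; last first.
    by move=> z zr; rewrite sum_indic_mul.
  rewrite swt_generator_sum big_distrr/= -big_split/= -sumrB.
  apply: (le_trans (ler_norm_sum _ _ _)).
  have M0 : 0 <= M by apply: le_trans (fM x xr).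
  apply: (@le_trans _ _ (\sum_(y <- r) (e / n%:R * h * M))).
    rewrite !big_seq; apply: ler_sum => y yr.
    rewrite mulrA -mulrDl -mulrBl normrM ler_pM// ?fM//.
    have := H h hd x xr y yr; set q := swt_generator _ _ => Hq.
    have -> : trans h x y - (\1_[set y] x + h * q) =
        (h^-1 * (trans h x y - \1_[set y] x) - q) * h.
      by rewrite mulrBl mulrAC mulVf ?gt_eqF// mul1r opprD addrA [q * h]mulrC.
    by rewrite normrM (gtr0_norm h0) ler_wpM2r ?(ltW h0).
  rewrite big_const_seq count_predT iter_addr_0 -[leLHS]mulr_natl.
  have -> : (size r)%:R * (e / n%:R * h * M) = (size r)%:R / n%:R * (e * h * M).
    by ring.
  rewrite -[leRHS]mul1r ler_wpM2r ?mulr_ge0 ?(ltW e0) ?(ltW h0)//.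
  by rewrite ler_pdivrMr// mul1r ler_nat.
Qed.

End law.

Arguments trans {R d Omega K} P X t x y.

(** * Potentials on the ring and sums over live particles *)

Section ring_geometry.
Context {K : nat}.
Implicit Types (k l x : 'I_K).

Lemma sum_ord_pred (R : realType) (F : 'I_K -> 'I_K -> R) :
  \sum_k F k (ord_pred k) = \sum_k F (ordS k) k.
Proof.
rewrite (reindex_inj (can_inj (@ordSK K))).
by apply: eq_bigr => k _; rewrite ordSK.
Qed.

Lemma ordS_neq k : (2 <= K)%N -> ordS k != k.
Proof.
move=> K2; rewrite -val_eqE/=; have kK := ltn_ord k.
have [kK1|kK1] := ltnP k.+1 K; first by rewrite modn_small//; lia.
have -> : k.+1 = K by lia.
by rewrite modnn; lia.
Qed.

(** The number of upward steps that lead from x to k. *)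
Definition gap x k : nat := (k + (K - x)) %% K.

Lemma gapE x k : gap x k = (if x <= k then k - x else k + K - x)%N.
Proof.
rewrite /gap; have kK := ltn_ord k; have xK := ltn_ord x.
case: leqP => xk.
  have -> : (k + (K - x) = k - x + K)%N by lia.
  by rewrite modnDr modn_small//; lia.
by rewrite modn_small; lia.
Qed.

Lemma gap_lt x k : (gap x k < K)%N.
Proof. by rewrite gapE; have kK := ltn_ord k; have xK := ltn_ord x; case: ifP; lia. Qed.

Lemma gapxx x : gap x x = 0%N.
Proof. by rewrite gapE leqnn subnn. Qed.

Lemma gap_gt0 x k : k != x -> (0 < gap x k)%N.
Proof.
rewrite -val_eqE/= gapE; have kK := ltn_ord k; have xK := ltn_ord x; case: ifP; lia.
Qed.

Lemma val_ordS k : ordS k = (if k.+1 < K then k.+1 else 0)%N :> nat.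
Proof.
rewrite /=; have kK := ltn_ord k.
case: ifP => kK1; first by rewrite modn_small.
have kE : k.+1 = K by lia.
by rewrite [X in (X %% _)%N]kE modnn.
Qed.

Lemma val_ord_pred k : ord_pred k = (if 0 < k then k.-1 else K.-1)%N :> nat.
Proof.
rewrite /=; have kK := ltn_ord k.
case: posnP => k0; first by rewrite k0 add0n modn_small//; lia.
have -> : ((k + K).-1 = k.-1 + K)%N by lia.
by rewrite modnDr modn_small//; lia.
Qed.

Lemma gap_ordS x k : gap x (ordS k) = (if (gap x k).+1 < K then (gap x k).+1 else 0)%N.
Proof.
have kK := ltn_ord k; have xK := ltn_ord x.
rewrite !gapE val_ordS; do ! case: ifP; lia.
Qed.

Lemma gap_ord_pred x k : k != x -> gap x (ord_pred k) = (gap x k).-1.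
Proof.
have kK := ltn_ord k; have xK := ltn_ord x.
rewrite -val_eqE/= !gapE val_ord_pred; do ! case: ifP; lia.
Qed.

Lemma gap_ordSl x k : gap (ordS x) k = gap x (ord_pred k).
Proof.
have kK := ltn_ord k; have xK := ltn_ord x.
rewrite !gapE val_ordS val_ord_pred; do ! case: ifP; lia.
Qed.

Lemma gap_eq0 x k : (gap x k == 0%N) = (k == x).
Proof.
apply/eqP/eqP => [|->]; last exact: gapxx.
by move=> g0; apply/eqP; apply: contraTT isT => /gap_gt0; rewrite g0.
Qed.

End ring_geometry.

Section profile.
Context {R : realType} {K : nat}.
Implicit Types (psi : nat -> R) (x k : 'I_K).

(** Absorption at x is encoded by the value 0 there. *)
Definition profile psi x k : R := if k == x then 0 else psi (gap x k).

Lemma profile_neighbours psi x k : k != x -> 0 <= psi 0%N -> 0 <= psi K ->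
  profile psi x (ordS k) + profile psi x (ord_pred k) <=
  psi (gap x k).+1 + psi (gap x k).-1.
Proof.
move=> kx p0 pK; have g0 := gap_gt0 kx; have gK := gap_lt x k.
rewrite /profile -!gap_eq0 gap_ordS gap_ord_pred//.
apply: lerD.
  case: ltnP => g1 //=.
  by have -> : (gap x k).+1 = K by lia.
by case: eqP => // ->.
Qed.

Lemma profile_neighbours_eq psi x k : k != x -> psi 0%N = 0 -> psi K = 0 ->
  profile psi x (ordS k) + profile psi x (ord_pred k) =
  psi (gap x k).+1 + psi (gap x k).-1.
Proof.
move=> kx p0 pK; have g0 := gap_gt0 kx; have gK := gap_lt x k.
rewrite /profile -!gap_eq0 gap_ordS gap_ord_pred//.
congr (_ + _).
  case: ltnP => g1 //=.
  by have -> : (gap x k).+1 = K by lia.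
by case: eqP => // ->.
Qed.

Definition wave_profile (L : R) (a : nat) : 'I_K -> 'I_K -> R :=
  profile (fun y => wave L (a + y)%:R).

(** An arch of sine wider than the ring is superharmonic off x, and it only
  loses by being set to 0 at x. *)
Lemma wave_profile_super (L : R) (a : nat) x k : 0 < L -> (a + K)%:R <= L ->
  k != x ->
  wave_profile L a x (ordS k) + wave_profile L a x (ord_pred k)
    - 2 * wave_profile L a x k <= - rate L * wave_profile L a x k.
Proof.
move=> L0 aKL kx; have g0 := gap_gt0 kx; set V := wave_profile L a x.
have H : V (ordS k) + V (ord_pred k) <= _ := profile_neighbours kx _ _.
apply: le_trans (lerD (H _ _) (lexx _)) _.
- by apply: wave_ge0 => //; rewrite ler0n (le_trans _ aKL)// ler_nat leq_add2l.
- by apply: wave_ge0 => //; rewrite ler0n.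
rewrite /V /wave_profile /profile (negbTE kx) -wave_laplacian.
apply: le_of_eq; congr (wave _ _ + wave _ _ - _).
  by rewrite natr1 addnS.
have -> : (a + gap x k = (a + (gap x k).-1).+1)%N by lia.
by rewrite -natr1 addrK.
Qed.

Lemma wave_profile_ge L a m x k : 0 < L -> (m <= a)%N -> (a + K + m)%:R <= L ->
  k != x -> m%:R / (2 * L) <= wave_profile L a x k.
Proof.
move=> L0 ma aKL kx; rewrite /wave_profile /profile (negbTE kx).
apply: wave_ge => //; rewrite ler_nat lerBrDr -natrD.
rewrite (leq_trans ma) ?leq_addr//= (le_trans _ aKL)// ler_nat.
by have := gap_lt x k; lia.
Qed.

Lemma wave_profile_ge0 L a x k : 0 < L -> (a + K)%:R <= L ->
  0 <= wave_profile L a x k.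
Proof.
move=> L0 aKL; rewrite /wave_profile /profile; case: ifP => // _.
apply: wave_ge0 => //; rewrite ler0n (le_trans _ aKL)// ler_nat.
by have := gap_lt x k; lia.
Qed.

Lemma wave_profile_le1 L a x k : wave_profile L a x k <= 1.
Proof.
by rewrite /wave_profile /profile; case: ifP => // _; exact: wave_le1.
Qed.

End profile.

Section live_particles.
Context {R : realType} {K : nat}.
Implicit Types (xi : config K) (k l j : 'I_K) (V : 'I_K -> R).

Definition live xi k : bool := val xi k == 1.

Lemma config_le1 xi k : val xi k <= 1.
Proof. by have /forallP := valP xi. Qed.

Lemma can_jumpE xi k l : can_jump xi k l = live xi k && ~~ live xi l.
Proof.
by rewrite /can_jump /live; have := config_le1 xi l; case: eqP => //= _; lia.
Qed.

Lemma can_jump_neq xi k l : can_jump xi k l -> k != l.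
Proof. by rewrite can_jumpE; case: eqP => // ->; case: live. Qed.

Lemma val_jumpE xi k l j : can_jump xi k l ->
  val (jump xi k l) j =
    if j == k then 0 else if j == l then val xi l + 1 else val xi j.
Proof. by move=> /val_jump ->; rewrite ffunE. Qed.

Lemma excess_jump xi k l : can_jump xi k l -> excess (jump xi k l) = excess xi.
Proof.
move=> jkl; have kl := can_jump_neq jkl.
rewrite /excess (bigD1 k)//= (bigD1 l)/= 1?eq_sym// [in RHS](bigD1 k)//=.
rewrite [in RHS](bigD1 l)/= 1?eq_sym//.
rewrite !val_jumpE// !eqxx eq_sym (negbTE kl).
have /andP[/eqP -> _] := jkl.
rewrite add0r addrCA addrA; congr (_ + _).
apply: eq_bigr => j /andP[jk jl].
by rewrite val_jumpE// (negbTE jk) (negbTE jl).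
Qed.

Definition livesum V xi : R := \sum_(k | live xi k) V k.

Lemma livesum_jump V xi k l : can_jump xi k l ->
  livesum V (jump xi k l) =
  livesum V xi - V k + (if val xi l == 0 then V l else 0).
Proof.
move=> jkl; have kl := can_jump_neq jkl.
have /andP[lk nl] : live xi k && ~~ live xi l by rewrite -can_jumpE.
rewrite /livesum big_mkcond [in RHS]big_mkcond.
have single (c : R) j0 : \sum_j (if j == j0 then c else 0) = c.
  by rewrite -big_mkcond big_pred1_eq.
rewrite -[X in _ - X + _](single _ k) -[X in _ - _ + X](single _ l).
rewrite -sumrB -big_split/=; apply: eq_bigr => j _.
rewrite /live in lk nl *; rewrite val_jumpE//; have [->|jk] := eqVneq j k.
  by rewrite lk (negbTE kl) subrr addr0.
have [->|jl] := eqVneq j l; last by rewrite subr0 addr0.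
rewrite (negbTE nl) subr0 add0r.
by have -> : (val xi l + 1 == 1) = (val xi l == 0) by rewrite -subr_eq0 addrK.
Qed.

(** Exclusion is invisible to sums over particles: the jump of a live particle
  onto a live one, which is suppressed, would be undone by the opposite jump. *)
Lemma sum_jumps V xi :
  \sum_(k < K) \sum_(l <- [:: ordS k; ord_pred k])
    (if can_jump xi k l then V l - V k else 0) =
  \sum_(k | live xi k) (V (ordS k) + V (ord_pred k) - 2 * V k).
Proof.
pose B k l := if live xi k && live xi l then V l - V k else 0.
transitivity (\sum_(k < K) ((if live xi k then V (ordS k) + V (ord_pred k) - 2 * V k
    else 0) - (B k (ordS k) + B k (ord_pred k)))).
  apply: eq_bigr => k _; rewrite big_cons big_seq1 !can_jumpE /B.
  case: (live xi k) => /=; last by rewrite !addr0 subr0.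
  by case: (live xi (ordS k)); case: (live xi (ord_pred k)) => /=; ring.
rewrite sumrB big_split/= (sum_ord_pred B) -big_mkcond/= -big_split/=.
rewrite [X in _ - X]big1 ?subr0// => k _; rewrite /B andbC.
by case: ifP => _; ring.
Qed.

Lemma generator_le V (f : config K -> R) xi :
  (forall k l, can_jump xi k l -> f (jump xi k l) - f xi <= V l - V k) ->
  swt_generator f xi <= \sum_(k | live xi k) (V (ordS k) + V (ord_pred k) - 2 * V k).
Proof.
move=> H; rewrite -sum_jumps; apply: ler_sum => k _; apply: ler_sum => l _.
by case: ifP => // /H.
Qed.

Lemma generator_eq V (f : config K -> R) xi :
  (forall k l, can_jump xi k l -> f (jump xi k l) - f xi = V l - V k) ->
  swt_generator f xi = \sum_(k | live xi k) (V (ordS k) + V (ord_pred k) - 2 * V k).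
Proof.
move=> H; rewrite -sum_jumps; apply: eq_bigr => k _; apply: eq_bigr => l _.
by case: ifP => // /H.
Qed.

End live_particles.

(** * Lower bound: absorption by one deep trap *)

Section finite_classes.
Context {K : nat}.
Implicit Types (A : set (config K)) (x : config K).

Definition elements A : seq (config K) := enum_fset (fset_set A).

Lemma elementsP A x : finite_set A -> reflect (A x) (x \in elements A).
Proof.
move=> fA; apply: (iffP idP) => [|Ax].
  by rewrite -[_ \in elements _]/(x \in fset_set A) in_fset_set// inE.
by rewrite -[_ \in elements _]/(x \in fset_set A) in_fset_set// inE.
Qed.

Lemma uniq_elements A : uniq (elements A).
Proof. exact: fset_uniq. Qed.

Lemma finite_excess (s : nat) : finite_set [set x : config K | excess x = s%:Z].
Proof.
pose g (h : {ffun 'I_K -> 'I_(2 * K).+1}) : config K :=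
  insubd (config0 K) [ffun k => 1 - (h k : nat)%:Z].
apply: (@sub_finite_set _ _ (g @` setT)); last exact/finite_image/finite_finset.
move=> x xs; exists [ffun k => inord `|1 - val x k|%N] => //.
apply/val_inj; rewrite val_insubd ifT; last first.
  by apply/forallP => k; rewrite ffunE lerBlDr lerDl.
apply/ffunP => k; rewrite !ffunE inordK; first by have := config_le1 x k; lia.
have le1 := config_le1 x k.
have : \sum_(j < K | j != k) val x j <= \sum_(j < K | j != k) 1.
  by apply: ler_sum => j _; exact: config_le1.
have : \sum_(j < K | j != k) (1 : int) <= \sum_(j < K) 1.
  by rewrite [leRHS](bigD1 k)//= lerDr.
rewrite [X in _ <= X -> _]sumr_const card_ord natz.
move: xs le1 (ltn_ord k); rewrite /= /excess (bigD1 k)//=.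
move: (sval x k) => v; set S1 := \sum_(j < K | _) _; set S2 := \sum_(j < K | _) _.
by move: S1 S2 => S1 S2; lia.
Qed.

End finite_classes.

Section expect_linear.
Context {R : realType} {T : eqType}.

Lemma expect_linear (r : seq T) (p : R -> T -> T -> R) t a b (f g : T -> R) x :
  expect r p t (fun y => a * f y + b * g y) x =
  a * expect r p t f x + b * expect r p t g x.
Proof.
rewrite /expect !big_distrr/= -big_split/=; apply: eq_bigr => y _.
by ring.
Qed.

End expect_linear.

Section absorption_by_one_trap.
Context {R : realType} {K : nat}.
Hypothesis K2 : (2 <= K)%N.

Let o : 'I_K := Ordinal (ltnW K2).

(** The worst initial condition: the excess is 0, so the exclusion process has
  nothing to do, and the particles have only one place to disappear. *)
Definition deep_trap : config K :=
  insubd (config0 K) [ffun j => if j == o then 1 - K%:Z else 1].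

Lemma val_deep_trap j : val deep_trap j = if j == o then 1 - K%:Z else 1.
Proof.
rewrite val_insubd ifT ?ffunE//; apply/forallP => k; rewrite ffunE.
by case: ifP => // _; rewrite lerBlDr lerDl.
Qed.

(** Closed under jumps, and small enough for the trap to be at o only: with
  excess 0 the site o cannot be live. *)
Definition one_trap_class : set (config K) :=
  [set x | excess x = 0%N%:Z /\ forall j, j != o -> 0 <= val x j].

Lemma finite_one_trap_class : finite_set one_trap_class.
Proof. by apply: sub_finite_set (finite_excess 0) => x []. Qed.

Lemma deep_trap_class : one_trap_class deep_trap.
Proof.
split; last by move=> j jo; rewrite val_deep_trap (negbTE jo).
rewrite /excess (bigD1 o)//= val_deep_trap eqxx.
rewrite (eq_bigr (fun=> 1)); last first.
  by move=> j jo; rewrite val_deep_trap (negbTE jo).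
rewrite sumr_const.
have -> : #|[pred i | i != o]| = K.-1 by rewrite (cardC1 o) card_ord.
by rewrite natz; lia.
Qed.

Lemma closed_one_trap_class : closed_class (elements one_trap_class).
Proof.
move=> x k l /(elementsP _ finite_one_trap_class)[ex x0] jkl.
apply/(elementsP _ finite_one_trap_class); split; first by rewrite excess_jump.
move=> j jo; rewrite val_jumpE//; case: ifP => // _; case: ifP => [/eqP jl|_].
  by rewrite addr_ge0// x0// -jl.
exact: x0.
Qed.

Lemma one_trap_not_live x : one_trap_class x -> ~~ live x o.
Proof.
move=> [ex x0]; apply/negP => /eqP xo.
move: ex; rewrite /excess (bigD1 o)//= xo.
have : 0 <= \sum_(j < K | j != o) val x j by apply: sumr_ge0 => j /x0.
by rewrite /=; move: (\sum_(j < K | _) _) => S; lia.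
Qed.

Let lam : R := rate K%:R.

Definition sine_profile : 'I_K -> R := wave_profile K%:R 0 o.

Let phi := sine_profile.
Let M : config K -> R := livesum phi.
Let pairs : config K -> R := fun x => M x ^+ 2 - livesum (fun k => phi k ^+ 2) x.

Let K0 : 0 < K%:R :> R. Proof. by rewrite ltr0n ltnW. Qed.

Let waveK : wave K%:R (K%:R : R) = 0.
Proof. by rewrite /wave mulfK ?gt_eqF// sinpi. Qed.

Lemma sine_profile_ge0 k : 0 <= phi k.
Proof. exact: wave_profile_ge0. Qed.

Lemma sine_profile_eigen k : k != o ->
  phi (ordS k) + phi (ord_pred k) - 2 * phi k = - lam * phi k.
Proof.
move=> ko; have g0 := gap_gt0 ko.
rewrite /phi /sine_profile /wave_profile profile_neighbours_eq ?wave0//.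
rewrite /profile (negbTE ko) -wave_laplacian.
rewrite !add0n; congr (wave _ _ + wave _ _ - _); first by rewrite natr1.
by rewrite -{2}(prednK g0) -natr1 addrK.
Qed.

(** A jump into the trap also fits the formula, as V vanishes there. *)
Lemma sine_sum_jump x k l (V : 'I_K -> R) : V o = 0 -> one_trap_class x ->
  can_jump x k l -> livesum V (jump x k l) - livesum V x = V l - V k.
Proof.
move=> Vo [_ x0] jkl; rewrite livesum_jump//.
have -> : (if val x l == 0 then V l else 0) = V l.
  case: eqVneq => // xl.
  have [->|lo] := eqVneq l o; first by rewrite Vo.
  by have := x0 l lo; move: jkl => /andP[_]; move/eqP: xl; lia.
by ring.
Qed.

Let phio : phi o = 0. Proof. by rewrite /phi /sine_profile /wave_profile /profile eqxx. Qed.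

Lemma generator_sine_sum x : one_trap_class x -> swt_generator M x = - lam * M x.
Proof.
move=> cx; rewrite (@generator_eq _ _ phi).
  rewrite /M /livesum big_distrr/=; apply: eq_bigr => k lk.
  rewrite sine_profile_eigen//; apply: contraTneq lk => ->.
  exact: one_trap_not_live.
by move=> k l jkl; apply: sine_sum_jump.
Qed.

(** The pair functional M ^ 2 - sum of phi ^ 2 decays at least at twice the rate
  of M. This is the negative correlation of the exclusion process, in the one
  instance that controls the variance of M. *)
Lemma generator_pairs x : one_trap_class x ->
  swt_generator pairs x <= - (2 * lam) * pairs x.
Proof.
move=> cx.
pose J (W : 'I_K -> 'I_K -> R) := \sum_(k < K) \sum_(l <- [:: ordS k; ord_pred k])
  (if can_jump x k l then W k l else 0).
have JD W1 W2 : J (fun k l => W1 k l + W2 k l) = J W1 + J W2.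
  rewrite /J -big_split/=; apply: eq_bigr => k _.
  rewrite -big_split/=; apply: eq_bigr => l _.
  by case: ifP; rewrite ?addr0.
have JZ c W : J (fun k l => c * W k l) = c * J W.
  rewrite /J big_distrr/=; apply: eq_bigr => k _.
  rewrite big_distrr/=; apply: eq_bigr => l _.
  by case: ifP; rewrite ?mulr0.
have phi2o : phi o ^+ 2 = 0 by rewrite phio expr2 mul0r.
have -> : swt_generator pairs x = J (fun k l => 2 * M x * (phi l - phi k) +
    ((phi l - phi k) ^+ 2 + (-1) * (phi l ^+ 2 - phi k ^+ 2))).
  apply: eq_bigr => k _; apply: eq_bigr => l _; case: ifP => // jkl.
  have E1 := @sine_sum_jump x k l phi phio cx jkl.
  have E2 := @sine_sum_jump x k l (fun k => phi k ^+ 2) phi2o cx jkl.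
  rewrite -[in RHS]E2 /pairs -/M.
  have -> : M (jump x k l) = M x + (phi l - phi k) by rewrite -E1 /M; ring.
  by ring.
rewrite (JD (fun k l => 2 * M x * (phi l - phi k))).
rewrite (JZ (2 * M x) (fun k l => phi l - phi k)).
rewrite (JD (fun k l => (phi l - phi k) ^+ 2)).
rewrite (JZ (-1) (fun k l => phi l ^+ 2 - phi k ^+ 2)).
rewrite [X in 2 * M x * X](sum_jumps phi x).
rewrite [X in -1 * X](sum_jumps (fun k => phi k ^+ 2) x).
have live_o k : live x k -> k != o.
  by move=> lk; apply: contraTneq lk => ->; exact: one_trap_not_live.
have -> : \sum_(k | live x k) (phi (ordS k) + phi (ord_pred k) - 2 * phi k) =
    - lam * M x.
  rewrite /M /livesum big_distrr/=; apply: eq_bigr => k lk.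
  by rewrite sine_profile_eigen// live_o.
have H : J (fun k l => (phi l - phi k) ^+ 2) <=
   \sum_(k | live x k) ((phi (ordS k) - phi k) ^+ 2 + (phi (ord_pred k) - phi k) ^+ 2).
  rewrite [leRHS]big_mkcond/=; apply: ler_sum => k _.
  rewrite big_cons big_seq1 !can_jumpE; case: (live x k) => /=; last by rewrite addr0.
  by apply: lerD; case: ifP => // _; exact: sqr_ge0.
have E : \sum_(k | live x k) ((phi (ordS k) - phi k) ^+ 2 + (phi (ord_pred k) - phi k) ^+ 2)
   = \sum_(k | live x k) (phi (ordS k) ^+ 2 + phi (ord_pred k) ^+ 2 - 2 * phi k ^+ 2)
     + 2 * lam * livesum (fun k => phi k ^+ 2) x.
  rewrite /livesum big_distrr/= -big_split/=; apply: eq_bigr => k lk.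
  have ke := sine_profile_eigen (live_o _ lk).
  have -> : 2 * lam * phi k ^+ 2 = - 2 * phi k * (- lam * phi k) by ring.
  by rewrite -ke; ring.
move: H; rewrite E /pairs; set S1 := \sum_(k | _) _; set S2 := livesum _ _.
by move: (J _) => j H; nra.
Qed.

Lemma sine_sum_ge0 x : 0 <= M x.
Proof. by apply: sumr_ge0 => k _; exact: sine_profile_ge0. Qed.

(** Multiplied by 2 sin b, with b = pi / (2 K), the sum telescopes: its value is
  the cotangent of b. *)
Lemma sum_sine : K%:R / pi <= \sum_(k < K) wave K%:R (k : nat)%:R :> R.
Proof.
have p0 := @pi_gt0 R; have p2 := @pihalf_lt2 R.
pose b := pi / (2 * K%:R) : R.
have b0 : 0 < b by rewrite divr_gt0// mulr_gt0.
have b1 : b <= 1.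
  rewrite ler_pdivrMr ?mulr_gt0// mul1r.
  have : 2 <= K%:R :> R by rewrite ler_nat.
  lra.
have tele : 2 * sin b * \sum_(k < K) wave K%:R (k : nat)%:R = 2 * cos b.
  pose c (k : nat) : R := - cos (pi * k%:R / K%:R - b).
  have -> : 2 * sin b * \sum_(k < K) wave K%:R (k : nat)%:R = \sum_(0 <= k < K) (c k.+1 - c k).
    rewrite big_mkord big_distrr/=; apply: eq_bigr => k _; rewrite /c /wave.
    have -> : pi * k.+1%:R / K%:R - b = pi * (k : nat)%:R / K%:R + b.
      by rewrite /b -addn1 natrD; field; rewrite gt_eqF.
    by rewrite cosD cosB; ring.
  rewrite telescope_sumr// /c mulr0 mul0r sub0r cosN mulfK ?gt_eqF//.
  by rewrite cosB cospi sinpi; ring.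
have sb : sin b <= b by exact/sin_le_id/ltW.
have sb0 : 0 < sin b by apply: sin_gt0_pi; rewrite b0 (le_lt_trans b1)// (lt_le_trans _ (pi_ge2 R))// ltr1n.
have cb : 1 / 2 <= cos b.
  by apply: le_trans (cos_ge_quadratic (ltW b0)); rewrite expr2; nra.
set S := \sum_(k < K) _ in tele *.
have S0 : 0 <= S.
  apply: sumr_ge0 => k _; apply: wave_ge0 => //.
  by rewrite ler0n ler_nat ltnW.
have bE : 2 * b = pi / K%:R by rewrite /b; field; rewrite gt_eqF.
rewrite -[K%:R / pi]invf_div -bE.
rewrite -div1r ler_pdivrMr; last lra.
have : sin b * S <= b * S by rewrite ler_wpM2r.
have : 2 * (sin b * S) = 2 * cos b by rewrite mulrA.
lra.
Qed.

Lemma sine_sum_deep_trap : K%:R / pi <= M deep_trap.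
Proof.
apply: (le_trans sum_sine); rewrite /M /livesum [leRHS]big_mkcond/=.
apply: ler_sum => k _; rewrite /live val_deep_trap /phi /sine_profile /wave_profile /profile.
have [->|ko] := eqVneq k o; first by rewrite /= wave0; case: ifP.
by rewrite /= gapE /= subn0.
Qed.

Context {d : measure_display} {Omega : measurableType d}.
Context {P : config K -> probability Omega R}.
Context {X : R -> {mfun Omega >-> config K}}.
Hypothesis HX : is_SWT P X.

Let r := elements one_trap_class.
Let rP x := elementsP x finite_one_trap_class.

Let mean t := expR (- lam * t) * M deep_trap.

(** Second moment method. By [generator_pairs] the mean of M ^ 2 is at most
  mean ^ 2 + mean, and 2 c M - c ^ 2 M ^ 2 is at most the indicator of M > 0;
  the best c is 1 / (mean + 1). *)
Lemma prob_not_absorbed t : 0 <= t ->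
  ((mean t / (mean t + 1))%:E <= P deep_trap (X t @^-1` ~` Sigma 0))%E.
Proof.
move=> t0; set m := mean t.
have S := swt_finite_semigroup HX (uniq_elements _) closed_one_trap_class.
have dr : deep_trap \in r by apply/rP; exact: deep_trap_class.
rewrite (prob_event HX _ (uniq_elements _) closed_one_trap_class dr t0) lee_fin.
have lam0 : 0 <= lam.
  rewrite /lam; have [|/ltW] // := @rate_inv R K%:R.
  by rewrite ler_nat.
have m0 : 0 <= m by rewrite mulr_ge0 ?expR_ge0 ?sine_sum_ge0.
have EM : m <= expect r (trans P X) t M deep_trap.
  have := expect_decay (f := fun x => -1 * M x + 0) S lam0 _ t0 dr.
  rewrite (expect_affine S)//.
  set E := expect _ _ _ _ _.
  rewrite /m /mean; set a := expR _ => H.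
  have : -1 * E + 0 <= a * (-1 * M deep_trap + 0).
    apply: H => x /rP cx.
    rewrite (_ : (fun y => _) = (fun y => \sum_(i <- [:: deep_trap]) M y * (-1))); last first.
      by apply/funext => y; rewrite big_seq1; ring.
    rewrite (@swt_generator_sum _ _ [:: deep_trap] (fun=> -1) (fun=> M)) big_seq1.
    by rewrite generator_sine_sum//; lra.
  by lra.
have EV : expect r (trans P X) t pairs deep_trap <= m ^+ 2.
  have l20 : 0 <= 2 * lam by rewrite mulr_ge0.
  apply: (le_trans (expect_decay S l20 _ t0 dr)).
    by move=> x /rP cx; exact: generator_pairs.
  rewrite /m /mean exprMn expr2 -expRD -mulrDl.
  have -> : - (2 * lam) = - lam + - lam by ring.
  rewrite ler_wpM2l ?expR_ge0// /pairs gerBl.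
  by apply: sumr_ge0 => k _; exact: sqr_ge0.
set c := (m + 1)^-1.
have mc : m * c = 1 - c by rewrite /c; field; rewrite gt_eqF//; lra.
have c0 : 0 < c by rewrite invr_gt0; lra.
have c1 : c <= 1 by rewrite invf_le1; lra.
apply: (@le_trans _ _ (expect r (trans P X) t
  (fun x => (2 * c - c ^+ 2) * M x + (- c ^+ 2) * pairs x) deep_trap)).
  rewrite expect_linear.
  have H1 : (2 * c - c ^+ 2) * m <= (2 * c - c ^+ 2) * expect r (trans P X) t M deep_trap.
    by rewrite ler_wpM2l//; nra.
  have H2 : c ^+ 2 * expect r (trans P X) t pairs deep_trap <= c ^+ 2 * m ^+ 2.
    by rewrite ler_wpM2l ?sqr_ge0.
  rewrite -/c mc.
  have : c ^+ 2 * m ^+ 2 = (1 - c) ^+ 2 by rewrite -mc; ring.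
  have : (2 * c - c ^+ 2) * m = (2 - c) * (1 - c) by rewrite -mc; ring.
  nra.
apply: (expect_le S) => // x /rP cx.
have M2 : livesum (fun k => phi k ^+ 2) x <= M x.
  apply: ler_sum => k _; rewrite expr2 ler_piMl ?sine_profile_ge0//.
  exact: wave_profile_le1.
have sq := sqr_ge0 (1 - c * M x).
rewrite indicE; have [inA|notA] := boolP (x \in ~` Sigma 0).
  rewrite /pairs; set s2 := livesum _ _ in M2 *.
  have : c ^+ 2 * s2 <= c ^+ 2 * M x by rewrite ler_wpM2l ?sqr_ge0.
  move: sq; rewrite /= ; nra.
have [x01 ex] : Sigma 0 x.
  by move: notA; rewrite notin_setE => /contrapT.
have xk k : ~~ live x k.
  move: ex; rewrite /excess (bigD1 k)//= => ex.
  have : 0 <= \sum_(j < K | j != k) val x j.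
    by apply: sumr_ge0 => j _; have [->|->] := x01 j.
  rewrite /live; move: ex; rewrite /=; move: (\sum_(j < K | _) _) => s1.
  by have [->|->] := x01 k => //; clear; lia.
have M0 V : livesum V x = 0 :> R.
  by rewrite /livesum big_pred0// => k; exact/negbTE.
by rewrite /pairs /M !M0 expr0n/= subrr !mulr0 addr0.
Qed.

Lemma max_dTV_ge t : 0 <= t ->
  ((mean t / (mean t + 1))%:E <= max_dTV P X t)%E.
Proof.
move=> t0; apply: (le_trans (prob_not_absorbed t0)).
apply: (@le_trans _ _ (dTV (distribution (P deep_trap) (X t))
    (uniform_on R (@Sigma K 0)))); last first.
  apply: ereal_sup_ubound; exists 0%N, deep_trap; split => //.
  by have [] := deep_trap_class.
apply: ereal_sup_ubound; exists (~` Sigma 0) => //.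
rewrite /uniform_on setICr fset_set0 cardfs0 mul0r sube0.
by rewrite gee0_abs// measure_ge0.
Qed.

Lemma mixing_time_ge eps : 0 < eps < 1 ->
  ((K%:R ^+ 2 / pi ^+ 2 * (ln K%:R - ln pi + ln (1 - eps)))%:E <=
    mixing_time P X eps)%E.
Proof.
move=> /andP[e0 e1]; apply: le_ereal_inf_tmp => _ [t [t0 te] <-].
rewrite lee_fin.
have p0 := @pi_gt0 R.
have := le_trans (max_dTV_ge t0) te; rewrite lee_fin.
set m := mean t => Hm.
have mM : expR (- lam * t) * (K%:R / pi) <= m.
  by rewrite ler_wpM2l ?expR_ge0 ?sine_sum_deep_trap.
have m0 : 0 < m by apply: lt_le_trans mM; rewrite mulr_gt0 ?expR_gt0 ?divr_gt0.
have m1 : m * (1 - eps) <= 1.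
  move: Hm; rewrite ler_pdivrMr; last lra.
  nra.
have : expR (- lam * t) * (K%:R / pi * (1 - eps)) <= 1.
  by rewrite mulrA (le_trans _ m1)// ler_wpM2r//; lra.
have q0 : 0 < K%:R / pi * (1 - eps) :> R by rewrite mulr_gt0 ?divr_gt0//; lra.
have -> : expR (- lam * t) * (K%:R / pi * (1 - eps)) =
    expR (- lam * t + (ln K%:R - ln pi + ln (1 - eps))).
  rewrite expRD; congr (_ * _).
  rewrite -ln_div ?posrE// -lnM ?posrE ?divr_gt0//; last lra.
  by rewrite lnK// posrE.
rewrite expR_le1 => H.
have : lam * t <= pi ^+ 2 / K%:R ^+ 2 * t by rewrite ler_wpM2r// rate_le.
set B := ln K%:R - ln pi + ln (1 - eps) in H * => H2.
have HB : B <= pi ^+ 2 / K%:R ^+ 2 * t by lra.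
have -> : t = K%:R ^+ 2 / pi ^+ 2 * (pi ^+ 2 / K%:R ^+ 2 * t).
  by move: (@pi R) p0 => p p0; field; rewrite !lt0r_neq0.
by rewrite ler_wpM2l// divr_ge0// sqr_ge0.
Qed.

End absorption_by_one_trap.

(** * Transience: filling the traps *)

Section block_potential.
Context {R : realType} {K : nat}.
Variables (o : 'I_K) (m : nat).
Hypothesis m0 : (0 < m)%N.
Implicit Types (x : config K) (i j k l : 'I_K).

Let L : R := (K + 4 * m)%:R.

Let K0 : (0 < K)%N. Proof. exact: leq_ltn_trans (ltn_ord o). Qed.

Let L0 : 0 < L. Proof. by rewrite ltr0n; lia. Qed.

Definition block_trap x j : bool := (val x j < 0) && (gap o j < m)%N.

Definition last_trap x j : bool :=
  block_trap x j && [forall i, block_trap x i ==> (gap o i <= gap o j)%N].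

Definition trap_profile j : 'I_K -> R := wave_profile L (gap o j + m) j.

(** The reference trap is the last one of the block that starts at o. The offsets
  [gap o j + m] unroll the ring from the reference trap while keeping the
  coordinate of the sites outside the block independent of that trap. *)
Definition block_potential x : R :=
  if [pick j | last_trap x j] is Some j then livesum (trap_profile j) x else 0.

Lemma exists_last_trap x i : block_trap x i -> exists j, last_trap x j.
Proof.
move=> ti; case: (@arg_maxnP _ i (block_trap x) (gap o) ti) => j tj Hj.
by exists j; rewrite /last_trap tj/=; apply/forallP => i'; apply/implyP => /Hj.
Qed.

Lemma trap_profile_ge0 j k : (gap o j < m)%N -> 0 <= trap_profile j k.
Proof. by move=> jm; apply: wave_profile_ge0 => //; rewrite ler_nat; lia. Qed.

Lemma trap_profile_ge j k : (gap o j < m)%N -> k != j ->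
  m%:R / (2 * L) <= trap_profile j k.
Proof.
by move=> jm kj; apply: wave_profile_ge => //; rewrite ?leq_addl// ler_nat; lia.
Qed.

Lemma gap_add j k : k != j ->
  (gap o j + gap j k = if gap o k < gap o j then gap o k + K else gap o k)%N.
Proof.
rewrite -val_eqE/= !gapE.
by have := ltn_ord o; have := ltn_ord j; have := ltn_ord k; do ! case: ifP; lia.
Qed.

(** When the last trap of the block is filled, the reference trap moves back to
  an earlier site of the block. Particles outside the block keep their
  coordinate; those between the two traps see it drop by K, hence move to the
  short end of the arch: no particle gains potential. *)
Lemma trap_profile_le j j' k : (gap o j' <= gap o j < m)%N -> k != j -> k != j' ->
  trap_profile j' k <= trap_profile j k.
Proof.
move=> /andP[jj jm] kj kj'.
rewrite /trap_profile /wave_profile /profile (negbTE kj) (negbTE kj').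
rewrite ![(gap o _ + m + _)%N]addnAC !gap_add//.
have [H'|H'] := boolP (gap o k < gap o j')%N; first by rewrite (leq_trans H').
case: ifP => // H.
apply: le_wave => //; first by rewrite ler_nat; lia.
by rewrite -natrD ler_nat; lia.
Qed.

Lemma trap_profile_super j k : (gap o j < m)%N -> k != j ->
  trap_profile j (ordS k) + trap_profile j (ord_pred k) - 2 * trap_profile j k
    <= - rate L * trap_profile j k.
Proof.
move=> jm kj; apply: wave_profile_super => //.
by rewrite ler_nat; lia.
Qed.

Lemma trap_before_jump x k l i : can_jump x k l -> val (jump x k l) i < 0 -> val x i < 0.
Proof.
move=> jkl; rewrite val_jumpE//; case: ifP => // _; case: ifP => // /eqP ->.
by move: jkl => /andP[_]; lia.
Qed.

Lemma livesum_trap_profile_jump x k l j : (gap o j < m)%N -> can_jump x k l ->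
  livesum (trap_profile j) (jump x k l) - livesum (trap_profile j) x <=
  trap_profile j l - trap_profile j k.
Proof.
move=> jm jkl; rewrite livesum_jump//.
have := trap_profile_ge0 l jm; case: ifP => _; lra.
Qed.

Lemma block_potential_jump x k l j : last_trap x j -> can_jump x k l ->
  block_potential (jump x k l) <= livesum (trap_profile j) (jump x k l).
Proof.
move=> /andP[tj /forallP Hj] jkl; rewrite /block_potential.
have /andP[xj jm] := tj.
case: pickP => [j' /andP[tj' /forallP Hj']|_]; last first.
  by apply: sumr_ge0 => i _; exact: trap_profile_ge0.
have /andP[xj' jm'] := tj'.
have jj : (gap o j' <= gap o j)%N.
  by apply: (implyP (Hj j')); rewrite /block_trap (trap_before_jump jkl xj').
apply: ler_sum => i li; apply: trap_profile_le; rewrite ?jj//.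
  apply: contraTneq li => ->; rewrite /live val_jumpE//.
  case: ifP => // _; case: ifP => [/eqP <-|_]; apply/negP => /eqP; move: xj; lia.
by apply: contraTneq li => ->; rewrite /live; apply/negP => /eqP; move: xj'; lia.
Qed.

(** Particles absorbed by other traps only lower the sum; the reference trap
  itself may be filled, which [trap_profile_le] controls. *)
Lemma generator_block_potential x :
  swt_generator block_potential x <= - rate L * block_potential x.
Proof.
rewrite {2}/block_potential; case: pickP => [j lj|none].
  have /andP[/andP[xj jm] _] := lj.
  apply: (le_trans (generator_le (V := trap_profile j) _)).
    move=> k l jkl.
    have -> : block_potential x = livesum (trap_profile j) x.
      rewrite /block_potential; case: pickP => [i li|/(_ j)]; last by rewrite lj.
      suff -> : i = j by [].
      move: li lj => /andP[ti /forallP Hi] /andP[tj /forallP Hj].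
      have : gap o i = gap o j.
        apply/eqP; rewrite eqn_leq (implyP (Hi j) tj) (implyP (Hj i) ti).
        by [].
      rewrite !gapE => gij; apply/val_inj => /=; move: gij.
      by have := ltn_ord o; have := ltn_ord j; have := ltn_ord i; do ! case: ifP; lia.
    apply: le_trans (livesum_trap_profile_jump jm jkl).
    by rewrite lerD2r; exact: block_potential_jump.
  rewrite /livesum big_distrr/=; apply: ler_sum => k lk.
  apply: trap_profile_super => //; apply: contraTneq lk => ->.
  by rewrite /live; apply/negP => /eqP; move: xj; lia.
have notrap y : (forall i, ~~ block_trap y i) -> block_potential y = 0.
  move=> H; rewrite /block_potential; case: pickP => // j /andP[tj _].
  by have := H j; rewrite tj.
have H i : ~~ block_trap x i.
  by apply/negP => /exists_last_trap[j]; rewrite none.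
rewrite mulr0; apply: (le_trans (generator_le (V := fun=> 0) _)).
  move=> k l jkl; rewrite !notrap ?subr0// => i.
  apply: contra (H i) => /andP[xi im].
  by rewrite /block_trap (trap_before_jump jkl xi).
by rewrite big1// => k _; rewrite addr0 mulr0 subr0.
Qed.

Lemma block_potential_ge0 x : 0 <= block_potential x.
Proof.
rewrite /block_potential; case: pickP => // j /andP[/andP[_ jm] _].
by apply: sumr_ge0 => k _; exact: trap_profile_ge0.
Qed.

Lemma block_potential_le x : block_potential x <= K%:R.
Proof.
rewrite /block_potential; case: pickP => // j _.
rewrite /livesum big_mkcond/= -[leRHS]mulr1 mulr_natl.
rewrite -[K in leRHS]card_ord -sumr_const; apply: ler_sum => k _.
by case: ifP => // _; exact: wave_profile_le1.
Qed.

(** The trap contributes at most - 1 to the excess s and the other sites at most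
  their live particle, so that s + 1 particles or more are live. *)
Lemma block_potential_trap x i (s : nat) : excess x = s%:Z -> block_trap x i ->
  s.+1%:R * (m%:R / (2 * L)) <= block_potential x.
Proof.
move=> xs ti; rewrite /block_potential.
case: pickP => [j /andP[/andP[xj jm] _]|none]; last first.
  by have [j] := exists_last_trap ti; rewrite none.
apply: (@le_trans _ _ (\sum_(k | live x k) m%:R / (2 * L))); last first.
  apply: ler_sum => k lk; apply: trap_profile_ge => //.
  by apply: contraTneq lk => ->; rewrite /live; apply/negP => /eqP; move: xj; lia.
rewrite sumr_const -[leRHS]mulr_natl ler_wpM2r ?divr_ge0 ?mulr_ge0 ?(ltW L0)//.
rewrite ler_nat -ltz_nat -xs /excess (bigD1 j)//=.
have : \sum_(k < K | k != j) val x k <= \sum_(k < K | live x k) 1.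
  rewrite [leRHS](bigID (fun k => k != j))/= [X in _ <= _ + X]big1; last first.
    move=> k /andP[lk]; rewrite negbK => /eqP kj; move: lk; rewrite kj.
    by rewrite /live => /eqP; move: xj; lia.
  rewrite addr0 big_mkcond [leRHS]big_mkcond/=; apply: ler_sum => k _.
  have := config_le1 x k; rewrite /live /= andbC; move: (sval x k) => v v1.
  by case: (k != j) => //=; case: eqP => [->//|]; lia.
rewrite sumr_const natz.
by move: xj; rewrite /=; move: (sval x j) (\sum_(k < K | _) _) #|_| => v S n; lia.
Qed.

End block_potential.

Section transience.
Context {R : realType} {K : nat}.
Variables (m b : nat).
Hypotheses (K0 : (0 < K)%N) (m0 : (0 < m)%N) (Kbm : (K <= b * m)%N).
Context {d : measure_display} {Omega : measurableType d}.
Context {P : config K -> probability Omega R}.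
Context {X : R -> {mfun Omega >-> config K}}.
Hypothesis HX : is_SWT P X.

Let L : R := (K + 4 * m)%:R.

Definition excess_class (s : nat) : set (config K) := [set x | excess x = s%:Z].

Lemma closed_excess_class s : closed_class (elements (excess_class s)).
Proof.
move=> x k l /(elementsP _ (finite_excess s)) xs jkl.
by apply/(elementsP _ (finite_excess s)); rewrite /excess_class/= excess_jump.
Qed.

Lemma not_Sigma_trap s (x : config K) : excess x = s%:Z -> ~ Sigma s x ->
  exists k, val x k < 0.
Proof.
move=> xs nS; apply: contrapT => H; apply: nS; split => // k.
have := config_le1 x k; have : ~ (val x k < 0) by move=> xk; apply: H; exists k.
by move: (val x k : int) => v; lia.
Qed.

(* The reduction modulo K only affects blocks that would start beyond the ring. *)
Let start (i : 'I_b) : 'I_K := Ordinal (ltn_pmod (i * m) K0).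

Lemma exists_block_trap (x : config K) k : val x k < 0 ->
  exists i : 'I_b, block_trap (start i) m x k.
Proof.
move=> xk; have kK := ltn_ord k.
have km : (k %/ m < b)%N by rewrite ltn_divLR//; exact: leq_trans kK Kbm.
exists (Ordinal km); rewrite /block_trap xk/= gapE /=.
have H := leq_divM k m.
rewrite modn_small; last exact: leq_ltn_trans H kK.
by rewrite H; have := ltn_ceil k m0; rewrite mulSn; lia.
Qed.

(** Markov inequality for each of the b blocks that cover the ring. *)
Lemma prob_trap_le s (x : config K) t : excess x = s%:Z -> 0 <= t ->
  (P x (X t @^-1` ~` Sigma s) <=
   (b%:R * (K%:R / s.+1%:R) * (2 * L / m%:R) * expR (- rate L * t))%:E)%E.
Proof.
move=> xs t0; pose r := elements (excess_class s).
have rP y := elementsP y (finite_excess s).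
have S := swt_finite_semigroup HX (uniq_elements _) (@closed_excess_class s).
have xr : x \in r by apply/rP.
have L0 : 0 < L by rewrite ltr0n; lia.
have L2 : 2 <= L by rewrite ler_nat; lia.
have m0R : 0 < m%:R :> R by rewrite ltr0n.
rewrite (prob_event HX _ (uniq_elements _) (@closed_excess_class s) xr t0) lee_fin.
pose c : R := 2 * L / m%:R / s.+1%:R.
have c0 : 0 <= c by rewrite !divr_ge0// mulr_ge0// ltW.
apply: (@le_trans _ _ (expect r (trans P X) t
   (fun y => \sum_(i < b) c * block_potential (start i) m y) x)).
  apply: (expect_le S) => // y /rP ys.
  have sum0 : 0 <= \sum_(i < b) c * block_potential (start i) m y.
    by apply: sumr_ge0 => i _; rewrite mulr_ge0// block_potential_ge0.
  rewrite indicE; case: (boolP (_ \in _)) => //; rewrite inE => nS.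
  have [k yk] := not_Sigma_trap ys nS.
  have [i ti] := exists_block_trap yk.
  rewrite (bigD1 i)//= -[leLHS]addr0; apply: lerD; last first.
    by apply: sumr_ge0 => j _; rewrite mulr_ge0// block_potential_ge0.
  have := block_potential_trap (R := R) m0 ys ti; rewrite -/L => H.
  apply: le_trans (ler_wpM2l c0 H).
  have E (l u v : R) : 0 < l -> 0 < u -> 0 < v ->
      1%:R = 2 * l / u / v * (v * (u / (2 * l))).
    by move=> l0 u0 v0; field; rewrite !lt0r_neq0.
  by apply: le_of_eq; apply: E.
rewrite /expect.
under eq_bigr do rewrite big_distrr/=.
rewrite exchange_big/=.
have term (i : 'I_b) : \sum_(y <- r) trans P X t x y * (c * block_potential (start i) m y)
    <= c * (expR (- rate L * t) * K%:R).
  have -> : \sum_(y <- r) trans P X t x y * (c * block_potential (start i) m y) =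
      c * expect r (trans P X) t (block_potential (start i) m) x.
    by rewrite /expect big_distrr/=; apply: eq_bigr => y _; ring.
  rewrite ler_wpM2l//.
  apply: (le_trans (expect_decay S (ltW (rate_inv L2).1) _ t0 xr)).
    by move=> y _; exact: generator_block_potential.
  by rewrite ler_wpM2l ?expR_ge0 ?block_potential_le.
apply: (le_trans (ler_sum _ (fun i _ => term i))).
rewrite sumr_const card_ord -[leLHS]mulr_natl.
by apply: le_of_eq; rewrite /c; ring.
Qed.

End transience.

(** * Exclusion as an interchange of sites *)

Section permuted_configurations.
Context {K : nat}.
Implicit Types (x y : config K) (k p q : 'I_K) (s : 'S_K).

Definition permute s x : config K := insubd x [ffun j => val x (s j)].

Lemma val_permute s x j : val (permute s x) j = val x (s j).
Proof.
rewrite val_insubd ifT ?ffunE//; apply/forallP => k; rewrite ffunE.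
exact: config_le1.
Qed.

Lemma config_eq x y : (forall k, val x k = val y k) -> x = y.
Proof. by move=> xy; apply/val_inj/ffunP. Qed.

Lemma permute_tpermK p q : involutive (permute (tperm p q)).
Proof. by move=> x; apply: config_eq => k; rewrite !val_permute tpermK. Qed.

Lemma permute_tperm_conj p q k l x :
  permute (tperm k l) (permute (tperm p q) x) =
  permute (tperm (tperm k l p) (tperm k l q)) (permute (tperm k l) x).
Proof.
apply: config_eq => j; rewrite !val_permute; congr (val x _).
have H : tperm (tperm k l p) (tperm k l q) = (tperm p q ^ tperm k l)%g.
  by rewrite tpermJ.
by rewrite H conjgE !permM tpermV tpermK.
Qed.

Lemma excess_permute s x : excess (permute s x) = excess x.
Proof.
rewrite /excess [RHS](reindex_inj (@perm_inj _ s)).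
by apply: eq_bigr => k _; rewrite val_permute.
Qed.

Definition binary x : Prop := forall k, val x k = 0 \/ val x k = 1.

Lemma binary_permute s x : binary x -> binary (permute s x).
Proof. by move=> bx k; rewrite val_permute. Qed.

Lemma Sigma_permute n s x : Sigma n x -> Sigma n (permute s x).
Proof.
by case=> bx ex; split; [exact: binary_permute|rewrite excess_permute].
Qed.

Lemma closed_Sigma n : closed_class (elements (@Sigma K n)).
Proof.
move=> x k l /(elementsP _ (finite_Sigma _ _))[bx ex] jkl.
apply/(elementsP _ (finite_Sigma _ _)); split; last by rewrite excess_jump.
move=> j; rewrite val_jumpE//; case: ifP => _; first by left.
case: ifP => _; last exact: bx.
by have /andP[_] := jkl; have [->|->] := bx l => // _; right.
Qed.

(** On particle configurations a jump exchanges the contents of two neighbouring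
  sites, and exchanging equal contents does nothing: the process is the
  interchange process seen without labels. *)
Lemma generator_binary (R : realType) (f : config K -> R) x : (2 <= K)%N ->
  binary x ->
  swt_generator f x = \sum_(k < K) (f (permute (tperm k (ordS k)) x) - f x).
Proof.
move=> K2 bx.
pose J k l := if can_jump x k l then f (jump x k l) - f x else 0.
transitivity (\sum_(k < K) (J k (ordS k) + J (ordS k) k)).
  rewrite big_split/= -(sum_ord_pred J) -big_split/=; apply: eq_bigr => k _.
  by rewrite big_cons big_seq1.
have jumpE k l : k != l -> can_jump x k l -> jump x k l = permute (tperm k l) x.
  move=> kl jkl; apply: config_eq => j; rewrite val_jumpE// val_permute.
  have /andP[/eqP xk] := jkl.
  have xl : val x l <= 0 -> val x l = 0 by have [->|->] := bx l.
  move=> /xl {}xl.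
  case: tpermP => [->|->|/eqP jk /eqP jl].
  - by rewrite eqxx xl.
  - by rewrite eqxx eq_sym (negbTE kl) xl xk add0r.
  - by rewrite (negbTE jk) (negbTE jl).
apply: eq_bigr => k _; have Sk := ordS_neq k K2; rewrite /J.
case: ifPn => j1; last case: ifPn => j2.
- have nj : can_jump x (ordS k) k = false.
    by move: j1; rewrite !can_jumpE => /andP[->]; rewrite andbF.
  by rewrite nj addr0 jumpE// eq_sym.
- by rewrite add0r jumpE// tpermC.
- rewrite addr0; suff -> : permute (tperm k (ordS k)) x = x by rewrite subrr.
  have xkl : val x k = val x (ordS k).
    move: j1 j2; rewrite !can_jumpE /live.
    by have [->|->] := bx k; have [->|->] := bx (ordS k).
  apply: config_eq => j; rewrite val_permute.
  by case: tpermP => [->|->|//].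
Qed.

End permuted_configurations.

Section pair_profile.
Context {R : realType} {K : nat}.
Hypothesis K2 : (2 <= K)%N.
Variables (L : R) (a : nat).
Hypotheses (L0 : 0 < L) (aKL : (a + K)%:R <= L).
Implicit Types (k p q : 'I_K).

Let g p q : R := wave_profile L a p q.

Let gxx p : g p p = 0. Proof. by rewrite /g /wave_profile /profile eqxx. Qed.

Let g_ordSl p q : g (ordS p) q = g p (ord_pred q).
Proof.
rewrite /g /wave_profile /profile gap_ordSl.
have -> // : (q == ordS p) = (ord_pred q == p).
by apply/eqP/eqP => [->|<-]; rewrite ?ordSK ?ord_predK.
Qed.

Let g_ord_predl p q : g (ord_pred p) q = g p (ordS q).
Proof. by rewrite -[in RHS](ord_predK p) g_ordSl ordSK. Qed.

(** Two sites exchanged edge by edge perform independent walks, except that they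
  annihilate across a common edge. The separation is thus a walk of double
  speed absorbed at 0, whence the factor 2 in the rate. *)
Lemma pair_profile_super p q : p != q ->
  \sum_(k < K) (if tperm k (ordS k) p == q then - 2 * g p q
                else g (tperm k (ordS k) p) (tperm k (ordS k) q) - g p q)
  <= - (2 * rate L) * g p q.
Proof.
move=> pq.
have H := wave_profile_super L0 aKL (x := p) (k := q).
rewrite eq_sym in H; have {}H := H pq.
have single (c : R) j0 : \sum_j (if j == j0 then c else 0) = c.
  by rewrite -big_mkcond big_pred1_eq.
apply: (@le_trans _ _ (\sum_(k < K)
  ((if k == p then g (ordS p) q - g p q else 0) +
   (if k == ord_pred p then g (ord_pred p) q - g p q else 0) +
   (if k == q then g p (ordS q) - g p q else 0) +
   (if k == ord_pred q then g p (ord_pred q) - g p q else 0)))); last first.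
  rewrite !big_split/= !single g_ordSl g_ord_predl.
  by move: H; rewrite -/(g p _) -/(g p _) -/(g p _); lra.
apply: ler_sum => k _; apply: le_of_eq.
have Sp i j : (i == ord_pred j) = (ordS i == j).
  by apply/eqP/eqP => [->|<-]; rewrite ?ordSK ?ord_predK.
have Sk := ordS_neq k K2.
rewrite !Sp; case: tpermP => [kp|kp|/eqP kp /eqP kp'].
- subst p; rewrite eqxx (negbTE Sk).
  have [Sq|Sq] := eqVneq (ordS k) q.
    by rewrite -Sq gxx (eq_sym k) (negbTE Sk) ordSK gxx; ring.
  by rewrite (negbTE pq) !addr0 tpermD.
- subst p; rewrite eqxx (eq_sym k (ordS k)) (negbTE Sk) ordSK.
  have [Sq|Sq] := eqVneq k q.
    by rewrite -Sq !gxx (negbTE Sk); ring.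
  by rewrite (negbTE pq) !addr0 add0r tpermD// eq_sym.
rewrite (negbTE pq); move: kp kp'; rewrite ![p == _]eq_sym.
move=> /negbTE -> /negbTE ->; rewrite !add0r.
case: tpermP => [->|->|/eqP kq /eqP kq'].
- by rewrite eqxx (negbTE Sk) addr0.
- by rewrite eqxx [k == _]eq_sym (negbTE Sk) add0r ordSK.
- move: kq kq'; rewrite ![q == _]eq_sym => /negbTE -> /negbTE ->.
  by rewrite addr0 subrr.
Qed.

End pair_profile.

(** * Mixing of the exclusion process *)

Section exclusion_mixing.
Context {R : realType} {K : nat}.
Hypothesis K2 : (2 <= K)%N.
Variables (m s : nat).
Hypothesis m0 : (0 < m)%N.
Context {d : measure_display} {Omega : measurableType d}.
Context {P : config K -> probability Omega R}.
Context {X : R -> {mfun Omega >-> config K}}.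
Hypothesis HX : is_SWT P X.
Implicit Types (x y : config K) (p q k : 'I_K) (f : config K -> R).

Let L : R := (K + 4 * m)%:R.
Let L0 : 0 < L. Proof. by rewrite ltr0n; lia. Qed.
Let L2 : 2 <= L. Proof. by rewrite ler_nat; lia. Qed.
Let m0R : 0 < m%:R :> R. Proof. by rewrite ltr0n. Qed.
Let g : 'I_K -> 'I_K -> R := wave_profile L (2 * m).
Let r := elements (@Sigma K s).
Let rP x := elementsP x (finite_Sigma K s).
Let S := swt_finite_semigroup HX (uniq_elements (@Sigma K s)) (@closed_Sigma K s).

Let aKL : (2 * m + K)%:R <= L. Proof. by rewrite ler_nat; lia. Qed.

Let g_ge p q : p != q -> m%:R / (2 * L) <= g p q.
Proof.
move=> pq; apply: wave_profile_ge => //; [lia|by rewrite ler_nat; lia|].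
by rewrite eq_sym.
Qed.

Let g_ge0 p q : 0 <= g p q. Proof. exact: wave_profile_ge0. Qed.

Let gmin0 : 0 < m%:R / (2 * L) :> R. Proof. by rewrite divr_gt0// mulr_gt0. Qed.

Let cancel : 2 * L / m%:R * (m%:R / (2 * L)) = 1.
Proof. by rewrite -[2 * L / _]invf_div mulVf// gt_eqF. Qed.

(** A Lipschitz condition for the exchange of two sites, where the price of an
  exchange depends on the positions of the sites only. *)
Definition exchange_level (c : R) f : Prop :=
  forall x p q, x \in r -> p != q -> f x - f (permute (tperm p q) x) <= c * g p q.

Let permute_r t x : x \in r -> permute t x \in r.
Proof. by move=> /rP xs; apply/rP; exact: Sigma_permute. Qed.

(** The exchange of the contents of p and q commutes with an exchange of
  neighbours up to moving p and q along, and it is undone when p and q are the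
  two neighbours. The step thus acts on prices as the generator of
  [pair_profile_super]. *)
Lemma exchange_level_step c f h : 0 <= c -> 0 < h < (2 * K%:R)^-1 ->
  exchange_level c f ->
  exchange_level ((1 - 2 * rate L * h) * c) (fun x => f x + h * swt_generator f x).
Proof.
move=> c0 /andP[h0 hK] Cf x p q xr pq.
set y := permute (tperm p q) x.
have yr : y \in r by exact: permute_r.
have [bx _] : Sigma s x by exact/rP.
have [by_ _] : Sigma s y by exact/rP.
rewrite !(generator_binary f K2)//.
set D := f x - f y.
have -> : f x + h * \sum_(k < K) (f (permute (tperm k (ordS k)) x) - f x) -
  (f y + h * \sum_(k < K) (f (permute (tperm k (ordS k)) y) - f y)) =
  D + h * \sum_(k < K) ((f (permute (tperm k (ordS k)) x) -
     f (permute (tperm k (ordS k)) y)) - D).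
  rewrite /D sumrB sumrB sumrB sumrB !sumr_const; ring.
have HD : D <= c * g p q by exact: Cf.
(* Each edge contributes at most c times the pair generator plus the surplus
  2 (c g - D); all the surpluses are absorbed by D itself as 2 K h <= 1. *)
apply: (@le_trans _ _ (D + h * \sum_(k < K)
  (c * (if tperm k (ordS k) p == q then - 2 * g p q
        else g (tperm k (ordS k) p) (tperm k (ordS k) q) - g p q)
   + 2 * (c * g p q - D)))).
  rewrite lerD2l ler_wpM2l ?(ltW h0)//; apply: ler_sum => k _.
  set t := tperm k (ordS k).
  have [tpq|tpq] := eqVneq (t p) q.
    have tE : t = tperm p q.
      move: tpq pq; rewrite /t; case: tpermP => [->->//|->->|_ _ ->]; last by rewrite eqxx.
      by rewrite tpermC.
    rewrite tE -/y /y permute_tpermK -/y.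
    have -> : f y - f x - D = - 2 * D by rewrite /D; ring.
    lra.
  have := Cf (permute t x) (t p) (t q) (permute_r t xr) _.
  rewrite (inj_eq perm_inj) pq => /(_ isT).
  by rewrite -permute_tperm_conj -/t -/y; lra.
rewrite big_split/= -big_distrr/= sumr_const card_ord -[_ *+ K]mulr_natr.
have PP := pair_profile_super K2 L0 aKL pq.
have := ler_wpM2l c0 PP; rewrite -/g => {}PP.
have := ler_wpM2l (ltW h0) PP.
have hK1 : h * (2 * K%:R) <= 1.
  by rewrite -ler_pdivlMr ?mul1r ?ltW// mulr_gt0// ltr0n ltnW.
have : h * (2 * K%:R) * (c * g p q - D) <= c * g p q - D.
  by rewrite ler_piMl// subr_ge0.
set G := \sum_(k < K) _; lra.
Qed.

Lemma exchange_level_perturb c f f' e : exchange_level c f ->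
  (forall y, y \in r -> `|f' y - f y| <= e) ->
  exchange_level (c + 4 * L / m%:R * e) f'.
Proof.
move=> Cf fe x p q xr pq.
have e0 : 0 <= e by exact: le_trans (fe _ xr).
have := fe _ xr; have := fe _ (permute_r (tperm p q) xr).
rewrite !ler_norml => /andP[H1 H2] /andP[H3 H4].
have := Cf x p q xr pq.
have H5 : 2 * e <= 4 * L / m%:R * e * g p q.
  have -> : 2 * e = 4 * L / m%:R * e * (m%:R / (2 * L)).
    by transitivity (2 * e * (2 * L / m%:R * (m%:R / (2 * L))));
      [rewrite cancel mulr1 | ring].
  by rewrite ler_wpM2l ?g_ge// mulr_ge0// divr_ge0// ?mulr_ge0// ltW.
by rewrite mulrDl; lra.
Qed.

Lemma expect_exchange f t x p q : 0 <= t -> (forall y, 0 <= f y <= 1) ->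
  x \in r -> p != q ->
  expect r (trans P X) t f x - expect r (trans P X) t f (permute (tperm p q) x)
    <= 2 * L / m%:R * expR (- (2 * rate L) * t).
Proof.
move=> t0 f01 xr pq.
have c0 : 0 <= 2 * L / m%:R by rewrite divr_ge0// ?mulr_ge0// ltW.
have Cf : exchange_level (2 * L / m%:R) f.
  move=> y i j yr ij.
  have /andP[_ f1] := f01 y; have /andP[f0 _] := f01 (permute (tperm i j) y).
  apply: (@le_trans _ _ 1); first lra.
  by rewrite -[leLHS]cancel ler_wpM2l ?g_ge.
have l0 : 0 <= 2 * rate L by rewrite mulr_ge0// ltW// (rate_inv L2).1.
have k0 : 0 <= 4 * L / m%:R by rewrite divr_ge0// ?mulr_ge0// ltW.
have h0 : 0 < (2 * K%:R)^-1 :> R by rewrite invr_gt0 mulr_gt0// ltr0n ltnW.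
apply/ler_addgt0Pr => e e0.
have H := expect_level S l0 k0 h0 (C := exchange_level) _ exchange_level_perturb
  exchange_level_step c0 t0 e0 Cf.
apply: (@le_trans _ _ ((expR (- (2 * rate L) * t) * (2 * L / m%:R) + e) * g p q)).
  apply: H => //.
  move=> c c' f' Cf' cc' y i j yr ij.
  by apply: (le_trans (Cf' y i j yr ij)); rewrite ler_wpM2r.
rewrite [2 * L / m%:R * _]mulrC ler_piMr ?wave_profile_le1//.
by rewrite addr_ge0 ?(ltW e0)// mulr_ge0// expR_ge0.
Qed.

Lemma exists_notin_of_card_eq (A B : {set 'I_K}) (p : 'I_K) : #|A| = #|B| -> p \in A ->
  p \notin B -> exists q, (q \in B) && (q \notin A).
Proof.
move=> AB pA pB; apply/existsP; apply: contraT => /existsPn H.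
have BA : B \subset A.
  by apply/fintype.subsetP => q qB; have := H q; rewrite qB negbK.
have /eqP BAE : B == A by rewrite eqEcard BA AB leqnn.
by rewrite BAE pA in pB.
Qed.

Let occ x : {set 'I_K} := [set k | live x k]%SET.

Let card_occ x : Sigma s x -> #|occ x| = s.
Proof.
move=> [bx ex]; apply/eqP; rewrite -eqz_nat -ex; apply/eqP.
rewrite /excess -sum1_card (big_morph Posz PoszD (erefl _)) [LHS]big_mkcond/=.
apply: eq_bigr => k _; rewrite inE /live.
by have [->|->] := bx k.
Qed.

Let occ_inj x y : Sigma s x -> Sigma s y -> occ x = occ y -> x = y.
Proof.
move=> [bx _] [by_ _] xy; apply: config_eq => k.
have : (k \in occ x) = (k \in occ y) by rewrite xy.
by rewrite !inE /live; have [->|->] := bx k; have [->|->] := by_ k.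
Qed.

(** Moving one by one the particles of x outside y to sites of y takes at most s
  exchanges. *)
Lemma expect_diameter f t x y : 0 <= t -> (forall z, 0 <= f z <= 1) ->
  x \in r -> y \in r ->
  expect r (trans P X) t f x - expect r (trans P X) t f y
    <= s%:R * (2 * L / m%:R * expR (- (2 * rate L) * t)).
Proof.
move=> t0 f01 xr yr; set A := 2 * L / m%:R * _.
have A0 : 0 <= A by rewrite mulr_ge0 ?expR_ge0// divr_ge0// ?mulr_ge0// ltW.
have base z : z \in r -> occ z \subset occ y ->
    expect r (trans P X) t f z - expect r (trans P X) t f y = 0.
  move=> zr zy; suff -> : z = y by rewrite subrr.
  apply: occ_inj; [exact/rP|exact/rP|].
  by apply/eqP; rewrite eqEcard zy !card_occ ?leqnn//; exact/rP.
have H n : forall z, z \in r -> (#|occ z :\: occ y| <= n)%N ->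
    expect r (trans P X) t f z - expect r (trans P X) t f y <= n%:R * A.
  elim: n => [|n IH] z zr.
    by rewrite leqn0 cards_eq0 finset.setD_eq0 => zy; rewrite base// mul0r.
  have [zy _|/fintype.subsetPn[p pz py] zn] := boolP (occ z \subset occ y).
    by rewrite base// mulr_ge0.
  have [|q /andP[qy qz]] := exists_notin_of_card_eq _ pz py.
    by rewrite !card_occ//; exact/rP.
  have pq : p != q by apply: contraTneq pz => ->.
  have zr' : permute (tperm p q) z \in r by exact: permute_r.
  have := expect_exchange t0 f01 zr pq.
  have := IH _ zr'; rewrite -/A.
  have -> : n.+1%:R * A = n%:R * A + A by rewrite -[n.+1%:R]natr1 mulrDl mul1r.
  suff zn' : (#|occ (permute (tperm p q) z) :\: occ y| <= n)%N.
    by move=> /(_ zn'); lra.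
  have pD : p \in occ z :\: occ y by apply/finset.setDP.
  rewrite -ltnS (leq_trans _ zn)// [in leqRHS](cardsD1 p) pD ltnS.
  move: pz py qy qz; rewrite !inE => pz py qy qz.
  apply: subset_leq_card; apply/fintype.subsetP => k.
  rewrite !inE /live val_permute.
  case: tpermP => [->|->|/eqP -> _ //]; last by rewrite -/(live y q) qy.
  by rewrite -/(live z q) (negbTE qz) andbF.
have xs : (#|occ x :\: occ y| <= s)%N.
  by rewrite -(card_occ (x := x)); [exact: subset_leq_card (finset.subsetDl _ _)|exact/rP].
exact: H.
Qed.

Lemma sum_permute f k l :
  \sum_(x <- r) f (permute (tperm k l) x) = \sum_(x <- r) f x.
Proof.
rewrite -(big_map (permute (tperm k l)) xpredT f); apply: perm_big.
have inj := inv_inj (@permute_tpermK K k l).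
apply: uniq_perm; rewrite ?map_inj_uniq ?uniq_elements// => x.
apply/mapP/idP => [[y yr ->]|xr]; first exact: permute_r.
by exists (permute (tperm k l) x); rewrite ?permute_r ?permute_tpermK.
Qed.

Lemma sum_generator f : \sum_(x <- r) swt_generator f x = 0.
Proof.
rewrite (eq_big_seq (fun x =>
    \sum_(k < K) (f (permute (tperm k (ordS k)) x) - f x))); last first.
  by move=> x /rP[bx _]; exact: generator_binary.
rewrite exchange_big/= big1// => k _.
by rewrite sumrB sum_permute subrr.
Qed.

Lemma sum_expect f t : 0 <= t ->
  \sum_(x <- r) expect r (trans P X) t f x = \sum_(x <- r) f x.
Proof.
move=> t0; apply/eqP; rewrite -subr_eq0 -normr_le0; apply/ler_addgt0Pr => e e0.
rewrite add0r.
pose C (c : R) (f' : config K -> R) :=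
  `|\sum_(x <- r) f' x - \sum_(x <- r) f x| <= c.
have C0 : C 0 f by rewrite /C subrr normr0.
have := expect_level S (C := C) (lexx 0) (ler0n R (size r)) ltr01 _ _ _ (lexx 0) t0 e0 C0.
rewrite mulr0 add0r; apply.
- by move=> c c' f' H cc'; exact: le_trans cc'.
- move=> c f1 f2 e1 H H'; rewrite /C.
  have -> : \sum_(x <- r) f2 x - \sum_(x <- r) f x =
    (\sum_(x <- r) f1 x - \sum_(x <- r) f x) + \sum_(x <- r) (f2 x - f1 x).
    by rewrite sumrB; ring.
  apply: (le_trans (ler_normD _ _)); apply: lerD => //.
  apply: (le_trans (ler_norm_sum _ _ _)).
  apply: (@le_trans _ _ (\sum_(x <- r) e1)).
    by rewrite big_seq [leRHS]big_seq; apply: ler_sum => x /H'.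
  by rewrite big_const_seq count_predT iter_addr_0 mulr_natl.
- move=> c f' h _ _ H; rewrite mul0r subr0 mul1r /C.
  by rewrite big_split/= -big_distrr/= sum_generator mulr0 addr0.
Qed.

Lemma uniform_on_sum (B : set (config K)) :
  uniform_on R (@Sigma K s) B = ((\sum_(x <- r) \1_B x) / (size r)%:R)%:E.
Proof.
rewrite /uniform_on; congr ((_ / _)%:E).
have fB : finite_set (Sigma s `&` B) by exact: finite_setIl (finite_Sigma K s).
have /perm_size -> : perm_eq (elements (Sigma s `&` B)) [seq x <- r | x \in B].
  apply: uniq_perm; rewrite ?filter_uniq ?uniq_elements// => x.
  rewrite mem_filter; apply/(elementsP _ fB)/andP => [[xS xB]|[xB /rP xS]].
    by split; [exact: mem_set|exact/rP].
  by split => //; exact: set_mem.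
rewrite size_filter -sum1_count natr_sum [in RHS]big_mkcond/= big_mkcond/=.
by apply: eq_bigr => x _; rewrite indicE; case: (x \in B).
Qed.

(** The sum over the class is invariant, so the uniform mean of f is also that of
  P_t f, which has small oscillation. *)
Lemma exclusion_mixing (B : set (config K)) t x : 0 <= t -> x \in r ->
  `|expect r (trans P X) t (\1_B : _ -> R) x - fine (uniform_on R (@Sigma K s) B)|
    <= s%:R * (2 * L / m%:R * expR (- (2 * rate L) * t)).
Proof.
move=> t0 xr; set A := _ * _.
have r0 : 0 < (size r)%:R :> R by rewrite ltr0n; case: r xr.
rewrite uniform_on_sum -(sum_expect _ t0)/=.
set E := expect _ _ _ _.
have -> : E x - (\sum_(y <- r) E y) / (size r)%:R =
    (\sum_(y <- r) (E x - E y)) / (size r)%:R.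
  rewrite sumrB big_const_seq count_predT iter_addr_0 mulrBl.
  by rewrite -(mulr_natr (E x)) mulfK// gt_eqF.
rewrite normrM normfV (gtr0_norm r0) ler_pdivrMr//.
apply: (le_trans (ler_norm_sum _ _ _)).
apply: (@le_trans _ _ (\sum_(y <- r) A)).
  rewrite big_seq [leRHS]big_seq; apply: ler_sum => y yr.
  have f01 z : 0 <= (\1_B z : R) <= 1 by rewrite indicE; case: (z \in B); rewrite ?lexx ler01.
  have := expect_diameter t0 f01 xr yr; have := expect_diameter t0 f01 yr xr.
  by rewrite -/A -/E ler_norml; lra.
by rewrite big_const_seq count_predT iter_addr_0 mulr_natr.
Qed.

End exclusion_mixing.

(** * Upper bound on the mixing time *)

Section mixing_upper_bound.
Context {R : realType} {K : nat}.
Hypothesis K2 : (2 <= K)%N.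
Context {d : measure_display} {Omega : measurableType d}.
Context {P : config K -> probability Omega R}.
Context {X : R -> {mfun Omega >-> config K}}.
Hypothesis HX : is_SWT P X.

Let arch (m : nat) : R := (K + 4 * m)%:R.

Lemma uniform_on_01 s (B : set (config K)) :
  0 <= fine (uniform_on R (@Sigma K s) B) <= 1.
Proof.
rewrite uniform_on_sum /=; set r := elements _.
have S0 : 0 <= \sum_(x <- r) (\1_B x : R).
  by apply: sumr_ge0 => x _; rewrite indicE.
have S1 : \sum_(x <- r) (\1_B x : R) <= (size r)%:R.
  apply: (@le_trans _ _ (\sum_(x <- r) 1)).
    by apply: ler_sum => x _; rewrite indicE lern1; case: (x \in B).
  by rewrite big_const_seq count_predT iter_addr_0.
rewrite divr_ge0//=; have [r0|r0] := posnP (size r).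
  by rewrite r0 invr0 mulr0.
by rewrite ler_pdivrMr ?ltr0n// mul1r.
Qed.

(** Markov property at time t1, when the traps should be filled. *)
Lemma prob_uniform_le (m b s : nat) (x : config K) t1 t2 (B : set (config K)) :
  (0 < m)%N -> (K <= b * m)%N -> 0 <= t1 -> 0 <= t2 -> excess x = s%:Z ->
  (`|P x (X (t1 + t2) @^-1` B) - uniform_on R (@Sigma K s) B| <=
    (b%:R * (K%:R / s.+1%:R) * (2 * arch m / m%:R) * expR (- rate (arch m) * t1) +
     s%:R * (2 * arch m / m%:R * expR (- (2 * rate (arch m)) * t2)))%:E)%E.
Proof.
move=> m0 Kbm t10 t20 xs; set L := arch m.
set A1 := b%:R * _ * _ * _; set A2 := s%:R * _.
pose r := elements (excess_class (K := K) s).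
have rP y := elementsP y (finite_excess (K := K) s).
have cr : closed_class r by exact: closed_excess_class.
have ur : uniq r := uniq_elements _.
have S := swt_finite_semigroup HX ur cr.
have xr : x \in r by apply/rP.
rewrite (prob_event HX _ ur cr xr (addr_ge0 t10 t20)).
have /andP[u0 u1] := uniform_on_01 s B.
set u := fine _ in u0 u1.
have -> : uniform_on R (@Sigma K s) B = u%:E by rewrite /u uniform_on_sum.
rewrite -EFinB abse_EFin lee_fin (expectD S)//.
set h := expect r _ t2 _.
have A20 : 0 <= A2.
  rewrite /A2 mulr_ge0// mulr_ge0 ?expR_ge0// divr_ge0// mulr_ge0//.
have hP y : y \in r -> `|h y - u| <= A2 + \1_(~` @Sigma K s) y.
  move=> yr; have hE := prob_event HX B ur cr yr t20.
  rewrite -/h in hE.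
  rewrite indicE; have [nS|/negP yS] := boolP (y \in ~` Sigma s).
    have h0 : 0 <= h y by rewrite -lee_fin -hE measure_ge0.
    have h1 : h y <= 1.
      by rewrite -lee_fin -hE probability_le1//; exact: measurable_event.
    by rewrite ler_norml; apply/andP; split => /=; lra.
  have {}yS : Sigma s y by apply: contrapT => nS; apply: yS; exact: mem_set.
  have ySr : y \in elements (@Sigma K s) by apply/(elementsP _ (finite_Sigma _ _)).
  have := prob_event HX B (uniq_elements _) (@closed_Sigma K s) ySr t20.
  rewrite hE => -[->]; rewrite addr0.
  exact: (exclusion_mixing K2 m0 HX B t20 ySr).
have bad : expect r (trans P X) t1 (\1_(~` @Sigma K s) : _ -> R) x <= A1.
  rewrite -lee_fin -(prob_event HX _ ur cr xr t10).
  by apply: prob_trap_le => //; exact: ltnW.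
have aff c e : expect r (trans P X) t1 (fun y => c * \1_(~` @Sigma K s) y + e) x =
    c * expect r (trans P X) t1 (\1_(~` @Sigma K s) : _ -> R) x + e.
  exact: (expect_affine S).
rewrite ler_norml; apply/andP; split.
  rewrite lerBrDr.
  apply: (@le_trans _ _ (expect r (trans P X) t1
    (fun y => -1 * \1_(~` @Sigma K s) y + (u - A2)) x)).
    by rewrite aff; lra.
  apply: (expect_le S) => // y yr; have := hP y yr; rewrite ler_norml => /andP[].
  by move: (h y) => hy; lra.
rewrite lerBlDr.
apply: (@le_trans _ _ (expect r (trans P X) t1
  (fun y => 1 * \1_(~` @Sigma K s) y + (u + A2)) x)).
  apply: (expect_le S) => // y yr; have := hP y yr; rewrite ler_norml => /andP[].
  by move: (h y) => hy; lra.
by rewrite aff; lra.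
Qed.

(** The transience time decreases with the number s + 1 of live particles needed
  to keep a trap, while the mixing time of the exclusion process increases with
  it: the two contributions of ln (s + 1) cancel in the total time, which does
  not depend on s. *)
Lemma mixing_time_le (m b : nat) eps : (0 < m)%N -> (0 < b)%N -> (K <= b * m)%N ->
  0 < eps < 1 ->
  (mixing_time P X eps <= ((ln K%:R + ln (20 * b%:R ^+ 2 / eps)
     + ln (20 * b%:R / eps)) / rate (arch m))%:E)%E.
Proof.
move=> m0 b0 Kbm /andP[e0 e1]; set L := arch m.
have L2 : 2 <= L by rewrite ler_nat; lia.
have [l0 _] := rate_inv L2.
have m0R : 0 < m%:R :> R by rewrite ltr0n.
have b1R : 1 <= b%:R :> R by rewrite ler1n.
have b2R : 1 <= b%:R ^+ 2 :> R by rewrite exprn_ege1.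
have K2R : 2 <= K%:R :> R by rewrite ler_nat.
have K0R : 0 < K%:R :> R by lra.
set w1 := 20 * b%:R ^+ 2 / eps; set w2 := 20 * b%:R / eps.
have w1E : w1 = 20 * b%:R ^+ 2 / eps by [].
have w2E : w2 = 20 * b%:R / eps by [].
have w1_20 : 20 <= w1 by rewrite w1E ler_pdivlMr//; nra.
have w2_20 : 20 <= w2 by rewrite w2E ler_pdivlMr//; nra.
clearbody w1 w2; set T := _ / rate L.
have LM : 2 * L / m%:R <= 10 * b%:R.
  have mbm : (m <= b * m)%N by rewrite leq_pmull.
  have : L <= (5 * (b * m))%:R by rewrite ler_nat; move: mbm Kbm; clear; lia.
  by rewrite ler_pdivrMr// !natrM -mulrA; lra.
have T0 : 0 <= T.
  by rewrite divr_ge0 ?(ltW l0)// !addr_ge0 ?ln_ge0//; lra.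
apply: ereal_inf_lbound; exists T => //; split => //.
apply: ge_ereal_sup => _ [s [x [sK xs ->]]].
apply: ge_ereal_sup => _ [B _ <-].
have s0R : 0 < s.+1%:R :> R by rewrite ltr0n.
have s1R : 1 <= s.+1%:R :> R by rewrite ler1n.
pose t2 := (ln s.+1%:R + ln w2) / rate L.
pose t1 := (ln K%:R - ln s.+1%:R + ln w1) / rate L.
have TE : T = t1 + t2 by rewrite /T /t1 /t2 -mulrDl; congr (_ / _); ring.
have t20 : 0 <= t2.
  by rewrite divr_ge0 ?(ltW l0)// addr_ge0 ?ln_ge0//; lra.
have E1 : expR (- rate L * t1) = s.+1%:R / (K%:R * w1).
  rewrite mulNr expRN /t1 mulrC divfK ?gt_eqF// expRD expRB !lnK ?posrE//; last lra.
  by rewrite invfM invf_div invfM mulrA.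
have t10 : 0 <= t1.
  rewrite divr_ge0 ?(ltW l0)//.
  have sK2 : s.+1%:R <= K%:R * w1.
    apply: (@le_trans _ _ (2 * K%:R)).
      by rewrite -natrM ler_nat; move: sK K2; clear; lia.
    by rewrite mulrC ler_pM2l//; lra.
  have : ln s.+1%:R <= ln (K%:R * w1) :> R.
    by rewrite ler_ln ?posrE// mulr_gt0//; lra.
  by rewrite lnM ?posrE//; lra.
have E2 : expR (- rate L * t2) = (s.+1%:R * w2)^-1.
  rewrite mulNr expRN /t2 mulrC divfK ?gt_eqF// expRD !lnK ?posrE//; lra.
rewrite /distribution /pushforward TE.
apply: (le_trans (prob_uniform_le B m0 Kbm t10 t20 xs)).
rewrite lee_fin -/L E1.
have H1 : b%:R * (K%:R / s.+1%:R) * (2 * L / m%:R) * (s.+1%:R / (K%:R * w1)) <= eps / 2.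
  have -> : b%:R * (K%:R / s.+1%:R) * (2 * L / m%:R) * (s.+1%:R / (K%:R * w1)) =
      b%:R * (2 * L / m%:R) / w1.
    have E (v k l w c : R) : 0 < v -> 0 < k -> 0 < w ->
        c * (k / v) * l * (v / (k * w)) = c * l / w.
      by move=> v0 k0 w0; field; rewrite !lt0r_neq0.
    by apply: E => //; lra.
  rewrite ler_pdivrMr; last lra.
  have -> : eps / 2 * w1 = b%:R * (10 * b%:R) by rewrite w1E; field; rewrite gt_eqF.
  by rewrite ler_wpM2l//; lra.
have H2 : s%:R * (2 * L / m%:R * expR (- (2 * rate L) * t2)) <= eps / 2.
  have e2 : expR (- (2 * rate L) * t2) <= (s.+1%:R * w2)^-1.
    rewrite -E2 ler_expR !mulNr lerN2 ler_wpM2r// mulrDl mul1r lerDl ltW//.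
  have L20 : 0 <= 2 * L / m%:R by rewrite divr_ge0// mulr_ge0.
  apply: (@le_trans _ _ (s.+1%:R * (10 * b%:R * (s.+1%:R * w2)^-1))).
    apply: ler_pM => //; first by rewrite mulr_ge0// expR_ge0.
      by rewrite ler_nat.
    by apply: ler_pM => //; rewrite expR_ge0.
  apply: le_of_eq; rewrite w2E.
  move: (s.+1%:R : R) s0R (b%:R : R) b1R => v v0 c c0; field.
  by rewrite !lt0r_neq0//; lra.
by rewrite [leRHS](splitr eps); exact: lerD.
Qed.

End mixing_upper_bound.

(** * Constants and cutoff *)

Section constants.
Context {R : realType}.

Lemma ln2_le1 : ln 2 <= 1 :> R.
Proof. by have := @le_ln1Dx R 1; rewrite -[1 + 1]/2; apply; lra. Qed.

Lemma ln2_ge : 1 / 2 <= ln 2 :> R.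
Proof.
have := @le_ln1Dx R (- (1 / 2)).
have -> : 1 + - (1 / 2) = 2^-1 :> R by field.
by rewrite lnV ?posrE//; lra.
Qed.

Variables (K : nat) (eps : R).
Hypotheses (K2 : (2 <= K)%N) (eps01 : 0 < eps < 1).

(** The width of the cutoff window in units of K ^ 2. It dominates both
  ln ln K and ln (1 / min), because ln ln 2 >= - ln 2 and min <= 1 / 2. *)
Definition window : R := 1 + ln (ln K%:R / Num.min eps (1 - eps)).

Let q : R := - ln (Num.min eps (1 - eps)).

Let mu0 : 0 < Num.min eps (1 - eps).
Proof. by have /andP[e0 e1] := eps01; rewrite lt_min e0; lra. Qed.

Let K2R : 2 <= K%:R :> R. Proof. by rewrite ler_nat. Qed.

Lemma lnK_ge : 1 / 2 <= ln K%:R :> R.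
Proof.
apply: (le_trans ln2_ge); rewrite ler_ln ?posrE//.
by apply: lt_le_trans K2R.
Qed.

Lemma windowE : window = 1 + ln (ln K%:R) + q.
Proof.
have lK : 0 < ln K%:R :> R by have := lnK_ge; lra.
by rewrite /window ln_div ?posrE// addrA.
Qed.

Let q_ge : ln 2 <= q.
Proof.
rewrite /q lerNr -lnV ?posrE// ler_ln ?posrE// ?mu0//.
have /andP[e0 e1] := eps01.
by rewrite ge_min; case: (lerP eps (1 / 2)) => H; apply/orP; [left|right]; lra.
Qed.

Let lnlnK_ge : - ln 2 <= ln (ln K%:R) :> R.
Proof.
have lK := lnK_ge.
rewrite -lnV ?posrE// ler_ln ?posrE//; lra.
Qed.

Lemma window_ge1 : 1 <= window.
Proof. by rewrite windowE; move: q_ge lnlnK_ge; lra. Qed.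

Lemma ln_min_le_window : - ln (Num.min eps (1 - eps)) <= window.
Proof. by rewrite windowE -/q; have := ln2_le1; move: lnlnK_ge; lra. Qed.

Lemma lnln_le_window : ln (ln K%:R) <= window.
Proof. by rewrite windowE; move: q_ge; have := ln2_ge; lra. Qed.

Lemma lnV_le_window (x : R) : Num.min eps (1 - eps) <= x -> - ln x <= window.
Proof.
move=> mx; apply: le_trans ln_min_le_window; rewrite lerN2 ler_ln ?posrE//.
exact: lt_le_trans mx.
Qed.

(** The number of blocks b is of order ln K: the arch is then wider than the ring
  by a relative 1 / ln K only, which costs O(K ^ 2) on K ^ 2 ln K, and the
  prefactors are powers of ln K, which cost O(K ^ 2 ln ln K). *)
Lemma upper_constants : exists m b : nat, [/\ (0 < m)%N, (0 < b)%N,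
  (K <= b * m)%N &
  (ln K%:R + ln (20 * b%:R ^+ 2 / eps) + ln (20 * b%:R / eps))
    / rate (K + 4 * m)%:R <= tstar R K + 1200 * K%:R ^+ 2 * window].
Proof.
have /andP[e0 e1] := eps01.
have K0 : (0 < K)%N by exact: ltnW.
pose b := trunc_log 2 K; pose m := (K %/ b).+1.
have b0 : (0 < b)%N by rewrite trunc_log_gt0.
have bK : (2 ^ b <= K)%N by apply: trunc_logP => //; exact: ltnW.
have Kb : (K < 2 ^ b.+1)%N by apply: trunc_log_ltn.
have bK' : (b <= K)%N by apply: leq_trans bK; exact/ltnW/ltn_expl.
exists m, b; split => //; first by rewrite /m mulnC; exact/ltnW/ltn_ceil.
have l21 := ln2_le1; have l2 := ln2_ge; have lK := lnK_ge.
have b1R : 1 <= b%:R :> R by rewrite ler1n.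
have lK_b : ln K%:R <= 2 * b%:R :> R.
  have : ln K%:R <= ln ((2 ^ b.+1)%:R : R).
    by rewrite ler_ln ?posrE ?ltr0n ?expn_gt0// ler_nat ltnW.
  rewrite natrX lnXn// -(mulr_natl (ln 2)) -addn1 natrD.
  by move: (ln K%:R) (ln 2) (b%:R : R) l21 b1R => x y z; nra.
have b_lK : b%:R <= 2 * ln K%:R :> R.
  have : ln ((2 ^ b)%:R : R) <= ln K%:R.
    by rewrite ler_ln ?posrE ?ltr0n ?expn_gt0// ler_nat.
  rewrite natrX lnXn// -(mulr_natl (ln 2)).
  by move: (ln K%:R) (ln 2) (b%:R : R) l2 b1R => x y z; nra.
set L : R := (K + 4 * m)%:R.
have bL : b%:R * L <= K%:R * (b%:R + 8).
  rewrite /L -natrD -!natrM ler_nat /m.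
  have := leq_divM K b; move: (K %/ b)%N bK' => c; clear; nia.
have L0 : 0 < L by rewrite ltr0n addn_gt0 K0.
have L2 : 2 <= L by rewrite ler_nat (leq_trans K2)// leq_addr.
have [l0 lV] := rate_inv L2.
have k2 : 2 <= K%:R :> R by [].
set k : R := K%:R in k2 lK_b b_lK bL *.
set lk := ln k in lK lK_b b_lK *.
set B : R := b%:R in b1R lK_b b_lK bL *.
clearbody B L.
have lk_k : lk <= k.
  by apply/ltW/ln_sublinear; lra.
have L9 : L <= 9 * k by nra.
have bL2 : B * L ^+ 2 <= k ^+ 2 * (B + 80).
  have H1 : B * (B * L ^+ 2) <= B * (k ^+ 2 * (B + 80)).
    have -> : B * (B * L ^+ 2) = (B * L) ^+ 2 by ring.
    apply: (@le_trans _ _ ((k * (B + 8)) ^+ 2)).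
      by rewrite ler_pXn2r ?nnegrE ?mulr_ge0//; lra.
    rewrite exprMn; nra.
  by move: H1; rewrite ler_pM2l//; lra.
have k20 : 0 <= k ^+ 2 by rewrite sqr_ge0.
have k24 : 2 * k <= k ^+ 2 by rewrite expr2 ler_wpM2r//; lra.
have L2lk : L ^+ 2 * lk <= k ^+ 2 * lk + 160 * k ^+ 2.
  have : B * (L ^+ 2 * lk) <= B * (k ^+ 2 * lk + 160 * k ^+ 2).
    have : B * L ^+ 2 * lk <= k ^+ 2 * (B + 80) * lk by rewrite ler_wpM2r//; lra.
    have : k ^+ 2 * lk <= k ^+ 2 * (2 * B) by rewrite ler_wpM2l.
    nra.
  by rewrite ler_pM2l//; lra.
have L81 : L ^+ 2 <= 81 * k ^+ 2.
  have -> : 81 * k ^+ 2 = (9 * k) ^+ 2 by ring.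
  by rewrite ler_pXn2r ?nnegrE//; lra.
have Y1 := window_ge1; have YV := lnV_le_window.
have Ylnln := lnln_le_window; rewrite -/k -/lk in Ylnln.
set Y := window in Y1 YV Ylnln *.
have eY : - ln eps <= Y by apply: YV; rewrite ge_min lexx.
have lnB : ln B <= 1 + Y.
  apply: (@le_trans _ _ (ln (2 * lk))).
    by rewrite ler_ln ?posrE//; lra.
  by rewrite lnM ?posrE//; lra.
have ln20 : ln 20 <= 19 :> R.
  have := @le_ln1Dx R 19.
  have -> : 1 + 19 = 20 :> R by ring.
  by apply; lra.
have W : ln (20 * B ^+ 2 / eps) + ln (20 * B / eps) <= 48 * Y.
  have B0 : 0 < B by lra.
  rewrite !ln_div ?posrE ?mulr_gt0 ?exprn_gt0//.
  rewrite expr2 !lnM ?posrE ?mulr_gt0//.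
  by move: (ln 20) (ln B) (ln eps) ln20 lnB eY => x y z; lra.
have W0 : 0 <= ln (20 * B ^+ 2 / eps) + ln (20 * B / eps).
  apply: addr_ge0; apply: ln_ge0; rewrite ler_pdivlMr//; nra.
move: W W0; rewrite -addrA; set w := ln _ + ln _ => W W0.
have p2 := @pi_ge2 R.
have p4 : 4 <= (@pi R) ^+ 2 by rewrite expr2; nra.
rewrite /tstar -/k -/lk.
move: (@pi R ^+ 2) p4 lV => pp p4 lV.
have ppV : 0 < pp^-1 <= 1 / 4.
  by rewrite invr_gt0 -[1 / 4]invf_div divr1 lef_pV2 ?posrE//; lra.
move: lV; rewrite -/(_ / _).
move: (pp^-1) ppV => ip /andP[ip0 ip1] lV.
apply: (@le_trans _ _ ((lk + w) * (L ^+ 2 * ip + 1))).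
  by rewrite ler_wpM2l//; lra.
have H1 : L ^+ 2 * lk * ip <= (k ^+ 2 * lk + 160 * k ^+ 2) * ip.
  by rewrite ler_wpM2r// ltW.
have H2 : 160 * k ^+ 2 * ip <= 40 * k ^+ 2 by nra.
have H3 : L ^+ 2 * ip + 1 <= 22 * k ^+ 2.
  have : L ^+ 2 * ip <= 81 * k ^+ 2 * (1 / 4).
    by rewrite ler_pM ?sqr_ge0 ?(ltW ip0).
  by move: k24; lra.
have H4 : w * (L ^+ 2 * ip + 1) <= 48 * Y * (22 * k ^+ 2).
  by rewrite ler_pM// addr_ge0// mulr_ge0 ?sqr_ge0 ?(ltW ip0).
have H5 : k ^+ 2 <= k ^+ 2 * Y by rewrite ler_peMr.
rewrite mulrDl [lk * _]mulrDr mulr1 [lk * (_ * _)]mulrA [lk * _]mulrC.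
by move: H1 H2 H4 H5; lra.
Qed.

(** The loss is K ^ 2 / pi ^ 2 times ln pi - ln (1 - eps). *)
Lemma lower_constants : tstar R K - 1200 * K%:R ^+ 2 * window <=
  K%:R ^+ 2 / pi ^+ 2 * (ln K%:R - ln pi + ln (1 - eps)).
Proof.
have /andP[e0 e1] := eps01.
have Y1 := window_ge1.
have eY : - ln (1 - eps) <= window by apply: lnV_le_window; rewrite ge_min lexx orbT.
have p2 := @pi_ge2 R.
have lp : ln pi <= 4 :> R.
  have := @pihalf_lt2 R; have : ln pi < pi :> R by apply: ln_sublinear; lra.
  lra.
have p4 : 4 <= (@pi R) ^+ 2 by rewrite expr2; nra.
rewrite /tstar; set k : R := K%:R; have k20 : 0 <= k ^+ 2 by rewrite sqr_ge0.
have ppV : 0 < (@pi R ^+ 2)^-1 <= 1 / 4.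
  by rewrite invr_gt0 -[1 / 4]invf_div divr1 lef_pV2 ?posrE//; lra.
move: ((pi ^+ 2)^-1) ppV => ip /andP[ip0 ip1].
have -> : k ^+ 2 * ln k * ip = k ^+ 2 * ip * ln k by ring.
have kip0 : 0 <= k ^+ 2 * ip by rewrite mulr_ge0// ltW.
have kip : k ^+ 2 * ip <= k ^+ 2 * 1 by rewrite ler_wpM2l//; lra.
have H : k ^+ 2 * ip * (ln pi - ln (1 - eps)) <= k ^+ 2 * 1 * (5 * window).
  apply: (@le_trans _ _ (k ^+ 2 * ip * (5 * window))).
    by rewrite ler_wpM2l//; lra.
  by rewrite ler_wpM2r//; lra.
nra.
Qed.

End constants.

Section cutoff.
Context {R : realType} {K : nat}.
Hypothesis K2 : (2 <= K)%N.
Context {d : measure_display} {Omega : measurableType d}.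
Context {P : config K -> probability Omega R}.
Context {X : R -> {mfun Omega >-> config K}}.
Hypothesis HX : is_SWT P X.

Lemma mixing_time_window eps : 0 < eps < 1 ->
  exists2 t : R, mixing_time P X eps = t%:E &
    `|t - tstar R K| <= 1200 * K%:R ^+ 2 * window K eps.
Proof.
move=> e01.
have lo := mixing_time_ge K2 HX e01.
have [m [b [m0 b0 Kbm Hhi]]] := upper_constants K2 e01.
have hi := mixing_time_le K2 HX m0 b0 Kbm e01.
have Hlo := lower_constants K2 e01.
move: lo hi; case: (mixing_time P X eps) => [t| |] //=.
rewrite !lee_fin => lo hi; exists t => //.
by rewrite ler_norml; lra.
Qed.

End cutoff.

(** As ln x <= 2 u for u = sqrt x, the window is O(u) for x = ln K. *)
Lemma window_small (R : realType) (eps c : R) : 0 < eps < 1 -> 0 < c ->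
  \forall K \near \oo, window K eps <= c * ln (K%:R : R).
Proof.
move=> e01 c0; pose q : R := - ln (Num.min eps (1 - eps)).
pose A : R := (`|q| + 3) / c + 1.
near=> K.
have K2 : (2 <= K)%N by near: K; exists 2%N.
have KA : expR (A ^+ 2) <= K%:R by near: K; exact: nbhs_infty_ger.
rewrite windowE// -/q.
have A1 : 1 <= A by rewrite /A lerDr divr_ge0// ltW.
set lk := ln K%:R.
have lkA : A ^+ 2 <= lk.
  by rewrite -[A ^+ 2]expRK ler_ln ?posrE ?expR_gt0// ltr0n ltnW.
have lk0 : 0 < lk by apply: lt_le_trans lkA; rewrite exprn_gt0//; lra.
pose u := Num.sqrt lk.
have uu : u ^+ 2 = lk by rewrite sqr_sqrtr// ltW.
have u0 : 0 < u by rewrite sqrtr_gt0.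
have uA : A <= u by rewrite -(@ler_pXn2r _ 2)// ?nnegrE ?uu//; lra.
have lu : ln lk <= 2 * u.
  rewrite -uu lnXn// mulr2n; have := ln_sublinear u0; lra.
have cA : `|q| + 3 <= c * A.
  by rewrite /A mulrDr mulr1 mulrCA mulfV ?gt_eqF// mulr1 lerDl ltW.
have cu : `|q| + 3 <= c * u by apply: (le_trans cA); rewrite ler_pM2l.
have -> : c * lk = c * u * u by rewrite -uu expr2 mulrA.
have := ler_norm q.
have : (`|q| + 3) * u <= c * u * u by rewrite ler_pM2r.
have : `|q| <= `|q| * u by rewrite ler_peMr//; lra.
by lra.
Unshelve. all: by end_near.
Qed.

Theorem theorem1p3 (R : realType) (d : nat -> measure_display)
    (Omega : forall K : nat, measurableType (d K))
    (P : forall K : nat, config K -> probability (Omega K) R)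
    (X : forall K : nat, R -> {mfun Omega K >-> config K})
    (SWT : forall K : nat, (1 <= K)%N -> is_SWT (P K) (X K)) :
  (exists2 C : R, 0 < C &
    forall (K : nat) (eps : R), (2 <= K)%N -> 0 < eps < 1 ->
      (`|mixing_time (P K) (X K) eps - (tstar R K)%:E| <=
       (C * K%:R ^+ 2 *
        (1 + ln (ln K%:R / Num.min eps (1 - eps))))%:E)%E)
  /\
  (forall eps : R, 0 < eps < 1 ->
    (mixing_time (P K) (X K) eps * ((tstar R K)^-1)%:E)%E @[K --> \oo]
      --> (1%:E : \bar R)).
Proof.
have [C C0 key] : exists2 C : R, 0 < C & forall K eps, (2 <= K)%N -> 0 < eps < 1 ->
    exists2 t : R, mixing_time (P K) (X K) eps = t%:E &
      `|t - tstar R K| <= C * K%:R ^+ 2 * window K eps.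
  exists 1200; first by rewrite ltr0n.
  by move=> K eps K2 e01; apply: mixing_time_window => //; exact/SWT/ltnW.
split.
  exists C => // K eps K2 e01; have [t -> Ht] := key K eps K2 e01.
  by rewrite -EFinB abse_EFin lee_fin.
move=> eps e01; apply: cvg_EFin.
  near=> K; have K2 : (2 <= K)%N by near: K; exists 2%N.
  by have [t -> _] := key K eps K2 e01.
apply/cvgrPdist_le => e e0.
have p0 : 0 < (@pi R) ^+ 2 by rewrite exprn_gt0// pi_gt0.
have c0 : 0 < e / (C * pi ^+ 2) by rewrite divr_gt0// mulr_gt0.
have := window_small e01 c0; apply: filter_app.
near=> K => Hw; have K2 : (2 <= K)%N by near: K; exists 2%N.
have [t /= -> Ht] := key K eps K2 e01.
have K0 : 0 < (K%:R : R) ^+ 2 by rewrite exprn_gt0// ltr0n ltnW.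
have lK : 0 < ln (K%:R : R) by apply: lt_le_trans (lnK_ge K2); lra.
have ts0 : 0 < tstar R K by rewrite /tstar divr_gt0// mulr_gt0.
rewrite /= distrC.
have -> : t * (tstar R K)^-1 - 1 = (t - tstar R K) / tstar R K.
  by rewrite mulrBl mulfV ?gt_eqF.
rewrite normrM normfV (gtr0_norm ts0) ler_pdivrMr//.
apply: (le_trans Ht).
apply: (@le_trans _ _ (C * K%:R ^+ 2 * (e / (C * pi ^+ 2) * ln K%:R))).
  by rewrite ler_wpM2l// mulr_ge0// ltW.
apply: le_of_eq; rewrite /tstar.
by move: (@pi R ^+ 2) p0 => pp p0; field; rewrite !gt_eqF.
Unshelve. all: by end_near.
Qed.
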